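(* Let $\mathbb{K}=\mathbb{C}$ and let $Q$ be a quantum system of parameters. Assume $G$ acts on both the quantum polynomial algebra $S_Q(V)$ and the quantum exterior algebra $\bigwedge_Q(V)$ as automorphisms. Let $\kappa$ be a quantum $2$-form. Then the factor algebra $\mathcal{H}_{Q,\kappa}$ is a quantum Drinfeld Hecke algebra if and only if $\kappa$ induces a Hochschild cocycle for $S_Q(V)\#G$.
   Context: $V$ is a finite-dimensional $\mathbb{C}$-vector space with fixed basis $v_1,\dots,v_n$, and $G\subset \mathrm{GL}(V)$ is a finite group. $\{t_g: g\in G\}$ is the standard basis of $\mathbb{C}G$, and $t_e$ is identified with $1$. $Q=(q_{ij})_{1\le i,j\le n}$ is a quantum system of parameters: nonzero scalars with $q_{ii}=1$, $q_{ij}=q_{ji}^{-1}$. $\kappa(v_i,v_j)\in\mathbb{C}G$ for $1\le i,j\le n$; $\kappa$ is a quantum $2$-form if $\kappa(v_i,v_i)=0$ and $\kappa(v_j,v_i)=-q_{ij}^{-1}\kappa(v_i,v_j)$ for all $i\ne j$. The algebra $\mathcal{H}_{Q,\kappa}$ is generated by $\{v_1,\dots,v_n\}\cup\{t_g: g\in G\}$ subject to: (a) $t_gt_h=t_{gh}$; (b) $t_g v=g(v)t_g$ for $g\in G$, $v\in V$; (c) $v_jv_i=q_{ij}v_iv_j+\kappa(v_i,v_j)$ for $1\le i,j\le n$. It is a quantum Drinfeld Hecke algebra if $\{v_1^{\alpha_1}\cdots v_n^{\alpha_n}t_g: \alpha_i\in\mathbb{N}, g\in G\}$ (with $0\in\mathbb{N}$)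 is a $\mathbb{C}$-basis of it. $S_Q(V)=\mathbb{C}\langle v_1,\dots,v_n\rangle/\langle v_jv_i-q_{ij}v_iv_j: i<j\rangle$. The quantum exterior algebra $\bigwedge_Q(V)$ is generated by $v_1,\dots,v_n$ with relations $v_i\wedge v_j=-q_{ji}\,v_j\wedge v_i$ for all $i,j$ (so $v_i\wedge v_i=0$); $\bigwedge^m_Q V$ is its degree $m$ part. $G$ acts as automorphisms on either algebra if the linear action of each $g\in G$ on $V$ extends to an algebra automorphism. $S_Q(V)\#G$ is the skew group algebra $S_Q(V)\otimes\mathbb{C}G$ with product $(at_g)(bt_h)=a\,g(b)\,t_{gh}$. Hochschild cocycles. Put $A=S_Q(V)$, $A^e=A\otimes A^{op}$, and $p_{ab}=q_{ba}$, so that $v_av_b=p_{ab}v_bv_a$ in $A$. The quantum Koszul resolution of $A$ by free $A^e$-modules has terms $A^e\otimes\bigwedge_Q^m V$ and differentials, for $j_1,\dots,j_m$ distinct, $$d(1\otimes1\otimes v_{j_1}\wedge\cdots\wedge v_{j_m})=\sum_{i=1}^m(-1)^{i+1}\Bigl[\Bigl(\prod_{s<i}p_{j_sj_i}\Bigr)v_{j_i}\otimes1-\Bigl(\prod_{s>i}p_{j_ij_s}\Bigr)1\otimes v_{j_i}\Bigr]\otimes v_{j_1}\wedge\cdots\widehat{v_{j_i}}\cdots\wedge v_{j_m}.$$ Applying $\mathrm{Hom}_{A^e}(-,A\#G)$ gives a complex computing $\mathrm{HH}^\bullet(A,A\#G)$, whose $2$-cochains are identified with $\mathrm{Hom}_{\mathbb{C}}(\bigwedge_Q^2V,A\#G)$.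 The quantum $2$-form $\kappa$ defines the $2$-cochain $f_\kappa$ with $f_\kappa(v_j\wedge v_i)=\kappa(v_i,v_j)\in\mathbb{C}G\subset A\#G$ (well defined because $\kappa$ is a quantum $2$-form). $G$ acts on cochains by $(h\cdot f)(w)=t_h\,f(h^{-1}w)\,t_{h^{-1}}$, and $\mathrm{HH}^\bullet(A,A\#G)^G\cong\mathrm{HH}^\bullet(A\#G)$, where $\mathrm{HH}^\bullet(C)=\mathrm{Ext}^\bullet_{C^e}(C,C)$ for an algebra $C$. ''$\kappa$ induces a Hochschild cocycle for $S_Q(V)\#G$'' means that $f_\kappa$ is a cocycle (i.e. $f_\kappa\circ d=0$ on $A^e\otimes\bigwedge_Q^3V$) and is $G$-invariant. *)

(* Defs.v *)
From HB Require Import structures.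
From mathcomp Require Import all_boot all_order all_algebra all_fingroup.
From mathcomp Require Import mxrepresentation complex.
From mathcomp Require Import ring_quotient generic_quotient.
From mathcomp Require Import boolp reals.
From mathcomp.multinomials Require Import monalg.

Set Implicit Arguments.
Unset Strict Implicit.
Unset Printing Implicit Defensive.

Import GRing.Theory.
Local Open Scope ring_scope.
Local Open Scope quotient_scope.

(* The free algebra K<I>: finitely supported functions on the words over I.    *)
Section FreeAlgebra.
Variables (K : fieldType) (I : choiceType).
Local Notation malgF := {malg K[{fmonom I}]}.

Lemma malgF_scaleU (a b : K) (m : {fmonom I}) :
  a *: (<< b *g m >> : malgF) = << a * b *g m >>.
Proof. by apply/malgP => l; rewrite [LHS]mcoeffZ [in LHS]mcoeffU [RHS]mcoeffU mulrnAr. Qed.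

Lemma malgF_mulU (a b : K) (m l : {fmonom I}) :
  (<< a *g m >> : malgF) * << b *g l >> = << a * b *g mmul m l >>.
Proof. exact: fgmulUU. Qed.

Lemma malgF_scaleAr (a : K) (x y : malgF) : a *: (x * y) = x * (a *: y).
Proof.
rewrite [x]monalgE !mulr_suml scaler_sumr; apply: eq_bigr => m _.
rewrite [y]monalgE [in RHS]scaler_sumr !mulr_sumr scaler_sumr.
apply: eq_bigr => l _; rewrite [a *: << _ *g _ >>]malgF_scaleU.
rewrite [in LHS]malgF_mulU [LHS]malgF_scaleU [RHS]malgF_mulU.
by congr << _ *g _ >>; exact: mulrCA.
Qed.

Lemma malgF_ind (P : malgF -> Prop) :
  P 0 -> P 1 -> (forall x y, P x -> P y -> P (x + y)) ->
  (forall a x, P x -> P (a *: x)) ->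
  (forall i x, P x -> P (<< fmu i >> * x)) -> forall x, P x.
Proof.
move=> P0 P1 PD PZ PM x; rewrite [x]monalgE.
elim/big_rec: _ => [|m y _ Py]; first exact: P0.
apply: PD; last exact: Py.
rewrite -[x@_m]mulr1 -malgF_scaleU; apply: PZ.
case: m => s; elim: s => [|i s IHs]; first by rewrite -fmE; exact: P1.
have -> : FMonom (i :: s) = mmul (fmu i) (FMonom s).
  by rewrite -[RHS]/(fmmul _ _) /fmmul /fmu !fmE.
by rewrite -[X in << X *g _ >>]mulr1 -malgF_mulU; exact: PM.
Qed.

Definition freealg := malgF.
HB.instance Definition _ := GRing.Lalgebra.on freealg.
HB.instance Definition _ :=
  GRing.Lalgebra_isAlgebra.Build K freealg malgF_scaleAr.

Definition fgen (i : I) : freealg := << fmu i >>.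

Lemma freealg_ind (P : freealg -> Prop) :
  P 0 -> P 1 -> (forall x y, P x -> P y -> P (x + y)) ->
  (forall a x, P x -> P (a *: x)) -> (forall i x, P x -> P (fgen i * x)) ->
  forall x, P x.
Proof. exact: malgF_ind. Qed.

End FreeAlgebra.

(* The quotient of an algebra by the two-sided ideal generated by rel. It may  *)
(* be the zero ring, so it is a pzRingType with a K-module structure, related  *)
(* by quotalg_scalerAl and quotalg_scalerAr, and not an algType.               *)
Section QuotientAlgebra.
Variables (K : fieldType) (A : algType K).

Inductive in_ideal (rel : A -> Prop) : A -> Prop :=
| ideal_gen a r b of rel r : in_ideal rel (a * r * b)
| ideal_zero : in_ideal rel 0
| ideal_add x y of in_ideal rel x & in_ideal rel y : in_ideal rel (x + y).

Variable rel : A -> Prop.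

Definition ideal_pred : A -> bool := fun x => `[< in_ideal rel x >].

Lemma in_idealM a x b : in_ideal rel x -> in_ideal rel (a * x * b).
Proof.
elim=> [c r d rr||y z _ IHy _ IHz].
- by rewrite !mulrA -mulrA; exact: ideal_gen.
- by rewrite mulr0 mul0r; exact: ideal_zero.
- by rewrite mulrDr mulrDl; exact: ideal_add.
Qed.

Lemma ideal_zmod_closed : zmod_closed ideal_pred.
Proof.
split=> [|x y /asboolP Ix /asboolP Iy]; apply/asboolP; first exact: ideal_zero.
by apply: ideal_add => //; rewrite -[- y]mulr1 -mulN1r; exact: in_idealM.
Qed.

HB.instance Definition _ := GRing.isZmodClosed.Build A ideal_pred ideal_zmod_closed.

Definition quotalg := Quotient.quot (GRing.ZmodClosed.clone A ideal_pred _).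
HB.instance Definition _ := GRing.Zmodule.on quotalg.
HB.instance Definition _ := EqQuotient.on quotalg.

Definition qproj (x : A) : quotalg := \pi_quotalg x.

Lemma qprojP x y : qproj x = qproj y <-> in_ideal rel (x - y).
Proof.
split=> [/eqP|H]; last apply/eqP; rewrite /qproj -Quotient.idealrBE.
  by move/asboolP.
exact/asboolP.
Qed.

Lemma qproj_repr (x : quotalg) : qproj (repr x) = x.
Proof. exact: reprK. Qed.

Lemma qprojD x y : qproj (x + y) = qproj x + qproj y.
Proof. exact: Quotient.pi_add. Qed.

Definition quotalg_one : quotalg := qproj 1.
Definition quotalg_mul (x y : quotalg) : quotalg := qproj (repr x * repr y).
Definition quotalg_scale (a : K) (x : quotalg) : quotalg := qproj (a *: repr x).

Lemma repr_qproj x : in_ideal rel (repr (qproj x) - x).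
Proof. by apply/qprojP; rewrite qproj_repr. Qed.

Lemma quotalg_mulE x y : quotalg_mul (qproj x) (qproj y) = qproj (x * y).
Proof.
apply/qprojP; set x' := repr _; set y' := repr _.
have -> : x' * y' - x * y = 1 * (x' - x) * y' + x * (y' - y) * 1.
  by rewrite mul1r mulr1 mulrBl mulrBr addrA subrK.
by apply: ideal_add; apply: in_idealM; exact: repr_qproj.
Qed.

Lemma quotalg_scaleE a x : quotalg_scale a (qproj x) = qproj (a *: x).
Proof.
apply/qprojP; rewrite -scalerBr -[_ - _]mul1r scalerAl -[_ * _]mulr1.
by apply: in_idealM; exact: repr_qproj.
Qed.

Let qE := (quotalg_mulE, quotalg_scaleE).

Lemma quotalg_mulA : associative quotalg_mul.
Proof.
move=> x y z; rewrite -[x]qproj_repr -[y]qproj_repr -[z]qproj_repr.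
by rewrite !qE mulrA.
Qed.

Lemma quotalg_mul1 : left_id quotalg_one quotalg_mul.
Proof. by move=> x; rewrite -[x]qproj_repr qE mul1r. Qed.

Lemma quotalg_mulr1 : right_id quotalg_one quotalg_mul.
Proof. by move=> x; rewrite -[x]qproj_repr qE mulr1. Qed.

Lemma quotalg_mulDl : left_distributive quotalg_mul +%R.
Proof.
move=> x y z; rewrite -[x]qproj_repr -[y]qproj_repr -[z]qproj_repr.
by rewrite !(qE, =^~ qprojD) mulrDl.
Qed.

Lemma quotalg_mulDr : right_distributive quotalg_mul +%R.
Proof.
move=> x y z; rewrite -[x]qproj_repr -[y]qproj_repr -[z]qproj_repr.
by rewrite !(qE, =^~ qprojD) mulrDr.
Qed.

HB.instance Definition _ := GRing.Zmodule_isPzRing.Build quotalg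
  quotalg_mulA quotalg_mul1 quotalg_mulr1 quotalg_mulDl quotalg_mulDr.

Lemma quotalg_scalerA a b x :
  quotalg_scale a (quotalg_scale b x) = quotalg_scale (a * b) x.
Proof. by rewrite -[x]qproj_repr !qE scalerA. Qed.

Lemma quotalg_scale1 : left_id 1 quotalg_scale.
Proof. by move=> x; rewrite -[x]qproj_repr qE scale1r. Qed.

Lemma quotalg_scaleDr : right_distributive quotalg_scale +%R.
Proof.
move=> a x y; rewrite -[x]qproj_repr -[y]qproj_repr.
by rewrite !(qE, =^~ qprojD) scalerDr.
Qed.

Lemma quotalg_scaleDl x : {morph quotalg_scale^~ x : a b / a + b}.
Proof.
by move=> a b; rewrite -[x]qproj_repr !(qE, =^~ qprojD) scalerDl.
Qed.

HB.instance Definition _ := GRing.Zmodule_isLmodule.Build K quotalg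
  quotalg_scalerA quotalg_scale1 quotalg_scaleDr quotalg_scaleDl.

Lemma qproj1 : qproj 1 = 1. Proof. by []. Qed.

Lemma qprojM x y : qproj (x * y) = qproj x * qproj y.
Proof. by rewrite -quotalg_mulE. Qed.

Lemma qprojZ a x : qproj (a *: x) = a *: qproj x.
Proof. by rewrite -quotalg_scaleE. Qed.

Lemma quotalg_scalerAl (a : K) (x y : quotalg) : a *: (x * y) = (a *: x) * y.
Proof.
rewrite -[x]qproj_repr -[y]qproj_repr.
by rewrite -qprojM -!qprojZ -qprojM scalerAl.
Qed.

Lemma quotalg_scalerAr (a : K) (x y : quotalg) : a *: (x * y) = x * (a *: y).
Proof.
rewrite -[x]qproj_repr -[y]qproj_repr.
by rewrite -qprojM -!qprojZ -qprojM scalerAr.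
Qed.

End QuotientAlgebra.

(* The algebra with generators I and relators rel (r stands for r = 0).        *)
Notation presalg K I rel := (@quotalg K (freealg K I) rel).

Definition pgen (K : fieldType) (I : choiceType) (rel : freealg K I -> Prop)
  (i : I) : presalg K I rel := qproj rel (fgen K i).

Lemma presalg_ind (K : fieldType) (I : choiceType) (rel : freealg K I -> Prop)
    (P : presalg K I rel -> Prop) :
  P 0 -> P 1 -> (forall x y, P x -> P y -> P (x + y)) ->
  (forall a x, P x -> P (a *: x)) -> (forall i x, P x -> P (pgen rel i * x)) ->
  forall x, P x.
Proof.
move=> P0 P1 PD PZ PM x; rewrite -[x]qproj_repr.
elim/freealg_ind: (repr x) => [|//|y z Py Pz|a y Py|i y Py].
- have -> // : qproj rel 0 = 0 by rewrite -[LHS](addrK (qproj rel 0)) -qprojD addr0 subrr.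
- by rewrite qprojD; exact: PD.
- by rewrite qprojZ; exact: PZ.
- by rewrite qprojM; exact: PM.
Qed.

(* An indexed family (so repetitions are excluded) is a K-basis.               *)
Definition is_basis (K : fieldType) (V : lmodType K) (B : eqType) (b : B -> V) :=
  (forall (s : seq B) (c : B -> K), uniq s ->
     \sum_(i <- s) c i *: b i = 0 -> forall i, i \in s -> c i = 0)
  /\ (forall x : V, exists (s : seq B) (c : B -> K), x = \sum_(i <- s) c i *: b i).

(* The skew group algebra A # G; the element \sum_g a_g t_g is the function    *)
(* g |-> a_g.                                                                  *)
Section SkewGroupAlgebra.
Variables (K : fieldType) (gT : finGroupType) (F : algType K) (rel : F -> Prop).
Local Notation A := (quotalg rel).

Record alg_action := AlgAction {
  act_fun :> gT -> {rmorphism A -> A};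
  act_scalable : forall g, scalable (act_fun g);
  act_one : forall x, act_fun 1%g x = x;
  act_mul : forall g h x, act_fun (g * h)%g x = act_fun g (act_fun h x)
}.

Variable act : alg_action.

Definition skew := let _ := act in {ffun gT -> A}.
HB.instance Definition _ := GRing.Lmodule.copy skew {ffun gT -> A}.

Definition skew_elt (a : A) (g : gT) : skew :=
  [ffun k => if k == g then a else 0].

(* (a t_g) (b t_h) = a g(b) t_gh, collected over gh = k *)
Definition skew_mul (x y : skew) : skew :=
  [ffun k => \sum_g x g * act g (y (g^-1 * k)%g)].

Lemma skew_mulA : associative skew_mul.
Proof.
move=> x y z; apply/ffunP => k; rewrite !ffunE.
under eq_bigr => g _.
  rewrite ffunE rmorph_sum mulr_sumr.
  under eq_bigr => h _ do rewrite rmorphM -act_mul mulrA.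
  rewrite (reindex_inj (mulgI g^-1%g)) /=.
  under eq_bigr => h _ do rewrite mulKVg invMg invgK mulgA -[(_ * g * _)%g]mulgA mulgV mulg1.
  over.
rewrite exchange_big /=; apply: eq_bigr => h _.
by rewrite ffunE mulr_suml.
Qed.

Lemma skew_mul1 : left_id (skew_elt 1 1%g) skew_mul.
Proof.
move=> x; apply/ffunP => k; rewrite ffunE (bigD1 1%g) //= big1 ?addr0.
  by rewrite ffunE eqxx mul1r act_one invg1 mul1g.
by move=> g /negPf g1; rewrite ffunE g1 mul0r.
Qed.

Lemma skew_mulr1 : right_id (skew_elt 1 1%g) skew_mul.
Proof.
move=> x; apply/ffunP => k; rewrite ffunE (bigD1 k) //= big1 ?addr0.
  by rewrite ffunE mulVg eqxx rmorph1 mulr1.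
by move=> g gk; rewrite ffunE -eq_mulVg1 (negPf gk) rmorph0 mulr0.
Qed.

Lemma skew_mulDl : left_distributive skew_mul +%R.
Proof.
move=> x y z; apply/ffunP => k; rewrite !ffunE -big_split /=.
by apply: eq_bigr => g _; rewrite ffunE mulrDl.
Qed.

Lemma skew_mulDr : right_distributive skew_mul +%R.
Proof.
move=> x y z; apply/ffunP => k; rewrite !ffunE -big_split /=.
by apply: eq_bigr => g _; rewrite ffunE rmorphD mulrDr.
Qed.

HB.instance Definition _ := GRing.Zmodule_isPzRing.Build skew
  skew_mulA skew_mul1 skew_mulr1 skew_mulDl skew_mulDr.

Lemma skew_scalerAl (a : K) (x y : skew) : a *: (x * y) = (a *: x) * y.
Proof.
apply/ffunP => k; rewrite !ffunE scaler_sumr.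
by apply: eq_bigr => g _; rewrite ffunE quotalg_scalerAl.
Qed.

Lemma skew_scalerAr (a : K) (x y : skew) : a *: (x * y) = x * (a *: y).
Proof.
apply/ffunP => k; rewrite !ffunE scaler_sumr.
by apply: eq_bigr => g _; rewrite ffunE act_scalable quotalg_scalerAr.
Qed.

Lemma skew_eltM a b g h :
  skew_elt a g * skew_elt b h = skew_elt (a * act g b) (g * h)%g.
Proof.
apply/ffunP => k; rewrite ffunE (bigD1 g) //= big1 ?addr0; last first.
  by move=> l /negPf lg; rewrite ffunE lg mul0r.
rewrite !ffunE eqxx (can2_eq (mulKVg g) (mulKg g)).
by case: eqP => // _; rewrite rmorph0 mulr0.
Qed.

Definition skew_alg (a : A) : skew := skew_elt a 1%g.
Definition skew_t (g : gT) : skew := skew_elt 1 g.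

End SkewGroupAlgebra.

(* V is the space K^n of column vectors and G acts on it through rho, so that  *)
(* g(v_i) = \sum_j rho(g)_{ji} v_j.                                            *)
Section GroupAction.
Variables (K : fieldType) (n : nat) (gT : finGroupType).
Variable rho : mx_representation K [set: gT]%G n.
Variable rel : freealg K 'I_n -> Prop.

Definition pvec (x : 'cV[K]_n) : presalg K 'I_n rel :=
  \sum_(i < n) x i ord0 *: pgen rel i.

Definition acts_as_automorphisms : Prop :=
  forall g : gT, exists phi : {rmorphism presalg K 'I_n rel -> presalg K 'I_n rel},
    [/\ bijective phi, scalable phi & forall x, phi (pvec x) = pvec (rho g *m x)].

Lemma pvec_delta i : pvec (delta_mx i ord0) = pgen rel i.
Proof.
rewrite /pvec (bigD1 i) //= big1 ?addr0 ?mxE ?eqxx ?scale1r //.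
by move=> j /negPf ji; rewrite mxE ji scale0r.
Qed.

Hypothesis acts : acts_as_automorphisms.

Let extends_rho (phi : gT -> {rmorphism presalg K 'I_n rel -> presalg K 'I_n rel}) :=
  forall g, [/\ bijective (phi g), scalable (phi g) &
    forall x, phi g (pvec x) = pvec (rho g *m x)].

Lemma ext_aut_exists : {phi | extends_rho phi}.
Proof. by exists (fun g => sval (cid (acts g))) => g; exact: svalP (cid (acts g)). Qed.

Definition ext_aut := sval ext_aut_exists.

Lemma ext_autP : extends_rho ext_aut.
Proof. exact: svalP ext_aut_exists. Qed.

Lemma ext_autZ g : scalable (ext_aut g).
Proof. by have [] := ext_autP g. Qed.

Lemma ext_aut_pvec g x : ext_aut g (pvec x) = pvec (rho g *m x).
Proof. by have [_ _ ->] := ext_autP g. Qed.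

Lemma ext_aut1 x : ext_aut 1%g x = x.
Proof.
elim/presalg_ind: x => [||x y Ex Ey|a x Ex|i x Ex].
- by rewrite rmorph0.
- by rewrite rmorph1.
- by rewrite rmorphD Ex Ey.
- by rewrite ext_autZ Ex.
- by rewrite rmorphM -pvec_delta ext_aut_pvec repr_mx1 mul1mx Ex.
Qed.

Lemma ext_autM g h x : ext_aut (g * h)%g x = ext_aut g (ext_aut h x).
Proof.
elim/presalg_ind: x => [||x y Ex Ey|a x Ex|i x Ex].
- by rewrite (rmorph0 (ext_aut h)) (rmorph0 (ext_aut g)) rmorph0.
- by rewrite (rmorph1 (ext_aut h)) (rmorph1 (ext_aut g)) rmorph1.
- by rewrite (rmorphD (ext_aut h)) (rmorphD (ext_aut g)) rmorphD Ex Ey.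
- by rewrite (ext_autZ h) (ext_autZ g) ext_autZ Ex.
- rewrite (rmorphM (ext_aut h)) (rmorphM (ext_aut g)) rmorphM Ex -pvec_delta; congr (_ * _).
  by rewrite !ext_aut_pvec mulmxA repr_mxM ?inE.
Qed.

(* The action by automorphisms; it is determined by its values on V.           *)
Definition ext_action : alg_action gT rel :=
  @AlgAction K gT _ rel ext_aut ext_autZ ext_aut1 ext_autM.

End GroupAction.

Section QuantumDrinfeldHecke.
Variables (K : fieldType) (n : nat) (gT : finGroupType).
Variable rho : mx_representation K [set: gT]%G n.
Variable q : 'M[K]_n.

Definition quantum_system : Prop :=
  [/\ forall i j, q i j != 0, forall i, q i i = 1 & forall i j, q i j = (q j i)^-1].

(* Only the vector space structure of the group algebra is needed: the element *)
(* \sum_g c_g t_g is the function g |-> c_g.                                   *)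
Definition grpalg := {ffun gT -> K}.

Definition quantum_2form (kap : 'I_n -> 'I_n -> grpalg) : Prop :=
  (forall i, kap i i = 0) /\
  (forall i j g, i != j -> kap j i g = - (q i j)^-1 * kap i j g).

Inductive qsym_rel : freealg K 'I_n -> Prop :=
| QSymRel (i j : 'I_n) of (i < j)%N :
    qsym_rel (fgen K j * fgen K i - q i j *: (fgen K i * fgen K j)).
Definition qsym := presalg K 'I_n qsym_rel.

(* For i = j the relation reads 2 w_i^2 = 0, hence w_i^2 = 0 outside           *)
(* characteristic 2.                                                           *)
Inductive qext_rel : freealg K 'I_n -> Prop :=
| QExtRel (i j : 'I_n) :
    qext_rel (fgen K i * fgen K j + q j i *: (fgen K j * fgen K i)).
Definition qext := presalg K 'I_n qext_rel.

Section HeckeAlgebra.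
Variable kap : 'I_n -> 'I_n -> grpalg.

Local Notation fv i := (fgen K (inl i : 'I_n + gT)%type).
Local Notation ft g := (fgen K (inr g : 'I_n + gT)%type).

Definition hecke_vec (x : 'cV[K]_n) : freealg K ('I_n + gT)%type :=
  \sum_(i < n) x i ord0 *: fv i.

Inductive hecke_rel : freealg K ('I_n + gT)%type -> Prop :=
| HeckeOne : hecke_rel (ft 1%g - 1)
| HeckeMul g h : hecke_rel (ft g * ft h - ft (g * h)%g)
| HeckeAct g (x : 'cV[K]_n) :
    hecke_rel (ft g * hecke_vec x - hecke_vec (rho g *m x) * ft g)
| HeckeComm i j :
    hecke_rel (fv j * fv i - (q i j *: (fv i * fv j) + \sum_g kap i j g *: ft g)).
Definition hecke := presalg K ('I_n + gT)%type hecke_rel.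

Definition hecke_monomial (a : {ffun 'I_n -> nat} * gT) : hecke :=
  (\prod_(i < n) pgen hecke_rel (inl i) ^+ a.1 i) * pgen hecke_rel (inr a.2).

Definition quantum_Drinfeld_Hecke : Prop := is_basis hecke_monomial.

End HeckeAlgebra.

Section Cocycle.
Hypothesis actS : acts_as_automorphisms rho qsym_rel.
Hypothesis actE : acts_as_automorphisms rho qext_rel.

Local Notation AG := (skew (ext_action actS)).
Local Notation v i := (skew_alg (ext_action actS) (pgen qsym_rel i)).
Local Notation t g := (skew_t (ext_action actS) g).
Local Notation w i := (pgen qext_rel i).
Local Notation p a b := (q b a).

Definition qext_degree m (x : qext) : Prop :=
  exists c : {ffun 'I_m -> 'I_n} -> K,
    x = \sum_j c j *: \prod_(s < m) w (j s).

(* A cochain in Hom_{A^e}(A^e (x) \wedge^m, A#G) is the bimodule extension     *)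
(* a (x) b (x) x |-> a f(x) b of a K-linear map f on \wedge^m. Such an f is    *)
(* given here as a linear map on the whole exterior algebra, of which only the *)
(* restriction to \wedge^m is used. koszul_coboundary f j is the value of      *)
(* f o d at 1 (x) 1 (x) w_{j_0} ... w_{j_m}; indices start at 0, so the sign   *)
(* is (-1)^i.                                                                  *)
Definition koszul_coboundary m (f : qext -> AG) (j : 'I_m.+1 -> 'I_n) : AG :=
  \sum_(i < m.+1)
    let fi := f (\prod_(s < m.+1 | s != i) w (j s)) in
    (-1) ^+ i *: ((\prod_(s < m.+1 | (s < i)%N) p (j s) (j i)) *: (v (j i) * fi)
                  - (\prod_(s < m.+1 | (i < s)%N) p (j i) (j s)) *: (fi * v (j i))).

(* The bimodule A^e (x) \wedge^{m+1} is generated by the products of distinct  *)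
(* generators, so f o d = 0 can be tested on these.                            *)
Definition is_cocycle m (f : qext -> AG) : Prop :=
  forall j : 'I_m.+1 -> 'I_n, injective j -> koszul_coboundary f j = 0.

Definition is_invariant m (f : qext -> AG) : Prop :=
  forall (h : gT) (x : qext), qext_degree m x ->
    t h * f (ext_action actE h^-1%g x) * t h^-1%g = f x.

Definition skew_grpalg (c : grpalg) : AG := \sum_g c g *: t g.

(* The values f(w_j w_i) determine f on \wedge^2.                              *)
Definition induces_cocycle (kap : 'I_n -> 'I_n -> grpalg) : Prop :=
  exists f : {linear qext -> AG},
    [/\ forall i j, f (w j * w i) = skew_grpalg (kap i j),
        is_cocycle 2 f & is_invariant 2 f].

End Cocycle.
End QuantumDrinfeldHecke.

(* Main.v *)
(* H_{Q,kappa} is the quotient of T(V) # G by the relators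
   v_j v_i - q_ij v_i v_j - kappa(v_i, v_j).  Comparing coefficients in degree 2
   of S_Q(V) and of the quantum exterior algebra, the two actions of G force
   rho_aj rho_bi q_ij = rho_aj rho_bi q_ba; hence t_g carries relators to
   combinations of relators as soon as kappa is invariant.  The Koszul cocycle
   condition for f_kappa says that the coefficients of all v_l t_g in the quantum
   Jacobi identity vanish, that is, the two ways of reordering v_c v_b v_a agree.
   Under both conditions a functional with prescribed values on sorted words
   extends, by induction on the length and then on the number of inversions, to
   a functional on T(V) # G killing the ideal of relators, as in Jacobson's proof
   of the Poincare-Birkhoff-Witt theorem; this yields the independence of the
   sorted monomials, and straightening shows that they span.  Conversely, in
   H_{Q,kappa} the Jacobi expression and the difference between the conjugate by
   t_g of a relation and its transform by g vanish identically, and the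
   independence of the v_l t_g and of the t_g turns this into the cocycle and
   invariance conditions. *)
Require Import Defs.
From HB Require Import structures.
From mathcomp Require Import all_boot all_order all_algebra all_fingroup.
From mathcomp Require Import finmap mxrepresentation complex reals.
From mathcomp Require Import boolp zify ring.
From mathcomp.multinomials Require Import monalg.

Set Implicit Arguments.
Unset Strict Implicit.
Unset Printing Implicit Defensive.

Import GRing.Theory.
Local Open Scope ring_scope.

(** * Words in presented algebras *)

(* Locked: failed unifications would otherwise unfold monalg. *)
HB.lock Definition fword (K : fieldType) (I : choiceType) (s : seq I) :
  freealg K I := << FMonom s >>.

Section Words.
Variables (K : fieldType) (I : choiceType).

Local Notation fword := (@fword K I).

Lemma fword_nil : fword [::] = 1.
Proof. by rewrite fword.unlock -fmoneE. Qed.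

Lemma fgen_fword i : fgen K i = fword [:: i].
Proof. by rewrite fword.unlock /fgen fmuE. Qed.

Lemma fwordM s t : fword s * fword t = fword (s ++ t).
Proof.
rewrite fword.unlock [LHS]malgF_mulU mulr1; congr << _ >>.
exact: fmmulE.
Qed.

Lemma fword_expansion (x : freealg K I) :
  exists (r : seq (seq I)) (c : seq I -> K), x = \sum_(s <- r) c s *: fword s.
Proof.
exists [seq val m | m <- msupp x], (fun s => x@_(FMonom s)).
rewrite big_map [LHS]monalgE; apply: eq_bigr => m _.
by rewrite fword.unlock [RHS]malgF_scaleU mulr1; case: m.
Qed.

(* Stated separately because rewriting with mulr_suml unfolds products of
   monalg. *)
Lemma freealg_suml (r : seq (seq I)) (c : seq I -> K) (y : freealg K I) :
  (\sum_(s <- r) c s *: fword s) * y = \sum_(s <- r) c s *: (fword s * y).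
Proof. by rewrite mulr_suml; apply: eq_bigr => s _; rewrite -scalerAl. Qed.

Lemma freealg_sumr (r : seq (seq I)) (c : seq I -> K) (y : freealg K I) :
  y * (\sum_(s <- r) c s *: fword s) = \sum_(s <- r) c s *: (y * fword s).
Proof. by rewrite mulr_sumr; apply: eq_bigr => s _; rewrite -scalerAr. Qed.

Definition sandwich (s t : seq I) (x : freealg K I) : freealg K I :=
  fword s * x * fword t.

Lemma sandwich_is_linear s t : linear (sandwich s t).
Proof.
by move=> a x y; rewrite /sandwich mulrDr mulrDl -scalerAr -scalerAl.
Qed.

HB.instance Definition _ s t := GRing.isLinear.Build K (freealg K I)
  (freealg K I) *:%R (sandwich s t) (sandwich_is_linear s t).

Lemma sandwich_fword s t r : sandwich s t (fword r) = fword (s ++ r ++ t).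
Proof. by rewrite /sandwich !fwordM catA. Qed.

Variables (M : lmodType K) (phi : seq I -> M).

Definition word_lift (x : freealg K I) : M := \sum_(m <- msupp x) x@_m *: phi m.

(** Lets the sums for x, y and a x + y run over one common index set, so that linearity can be
    checked termwise. *)
Lemma word_lift_widen (d : {fset {fmonom I}}) x : (msupp x `<=` d)%fset ->
  word_lift x = \sum_(m <- d) x@_m *: phi m.
Proof.
move=> sxd; rewrite /word_lift (big_fset_incl _ sxd) // => m _ /mcoeff_outdom ->.
by rewrite scale0r.
Qed.

Lemma word_lift_is_linear : linear word_lift.
Proof.
move=> a x y.
have sd1 : (msupp (a *: x + y) `<=` msupp x `|` msupp y)%fset.
  apply: fsubset_trans (msuppD_le _ _) _; apply: fsetSU; exact: msuppZ_le.
rewrite (word_lift_widen sd1) (word_lift_widen (fsubsetUl _ (msupp y))).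
rewrite (word_lift_widen (fsubsetUr (msupp x) _)) scaler_sumr -big_split /=.
by apply: eq_bigr => m _; rewrite mcoeffD mcoeffZ scalerDl scalerA.
Qed.

Lemma freealg_lift :
  exists L : {linear freealg K I -> M}, forall s, L (fword s) = phi s.
Proof.
pose L : {linear freealg K I -> M} := HB.pack word_lift
  (GRing.isLinear.Build K (freealg K I) M *:%R word_lift word_lift_is_linear).
exists L => s.
by rewrite /= /word_lift fword.unlock msuppU1 big_seq_fset1 mcoeffU1 eqxx scale1r.
Qed.

End Words.

Lemma linear_comb (K : fieldType) (U W : lmodType K) (f : {linear U -> W})
    (T : Type) (r : seq T) (c : T -> K) (F : T -> U) :
  f (\sum_(t <- r) c t *: F t) = \sum_(t <- r) c t *: f (F t).
Proof. by rewrite linear_sum; apply: eq_bigr => t _; rewrite linearZ. Qed.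

Section PresentedMaps.
Variables (K : fieldType) (I : choiceType) (rel : freealg K I -> Prop).

Definition pword (s : seq I) : presalg K I rel := qproj rel (fword K s).

Lemma pword_nil : pword [::] = 1.
Proof. by rewrite /pword fword_nil. Qed.

Lemma pgen_pword i : pgen rel i = pword [:: i].
Proof. by rewrite /pgen fgen_fword. Qed.

Lemma pword_cat s t : pword (s ++ t) = pword s * pword t.
Proof. by rewrite /pword -fwordM qprojM. Qed.

Lemma pword_cons i s : pword (i :: s) = pgen rel i * pword s.
Proof. by rewrite -cat1s pword_cat pgen_pword. Qed.

Lemma qproj_rel x y : rel (x - y) -> qproj rel x = qproj rel y.
Proof.
by move=> r; apply/qprojP; rewrite -[x - y]mulr1 -[x - y]mul1r; apply: ideal_gen.
Qed.

Lemma qproj_is_linear : linear (qproj rel).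
Proof. by move=> a x y; rewrite qprojD qprojZ. Qed.

HB.instance Definition _ := GRing.isLinear.Build K (freealg K I)
  (presalg K I rel) *:%R (qproj rel) qproj_is_linear.

Lemma qproj_gen_sum (T : finType) (c : T -> K) (F : T -> I) :
  qproj rel (\sum_t c t *: fgen K (F t)) = \sum_t c t *: pgen rel (F t).
Proof. exact: linear_comb. Qed.

(** The ideal is spanned by the products a r b with r a relator; expanding a and b into words
    reduces to relators placed between two words. *)
Lemma presalg_lift (M : lmodType K) (L : {linear freealg K I -> M}) :
    (forall s t r, rel r -> L (sandwich s t r) = 0) ->
  exists f : {linear presalg K I rel -> M}, forall x, f (qproj rel x) = L x.
Proof.
move=> L_rel.
have kill x : in_ideal rel x -> L x = 0.
  elim=> [a r b rr||y z _ Hy _ Hz]; last by rewrite linearD /= Hy Hz addr0.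
    have [ra [ca ->]] := fword_expansion a; have [rb [cb ->]] := fword_expansion b.
    rewrite -mulrA (freealg_suml ra ca) linear_sum big1 // => s _.
    rewrite linearZ /= mulrA (freealg_sumr rb cb) linear_sum big1 ?scaler0 // => t _.
    by rewrite linearZ /= -/(sandwich s t r) L_rel // scaler0.
  by rewrite linear0.
have proj x : L (generic_quotient.repr (qproj rel x)) = L x.
  by apply/eqP; rewrite -subr_eq0 -linearB kill //; exact: repr_qproj.
pose f (x : presalg K I rel) := L (generic_quotient.repr x).
have f_lin : linear f.
  move=> a x y; rewrite -[x]qproj_repr -[y]qproj_repr -linearZ -linearD.
  by rewrite /f !proj linearD linearZ.
pose fl : {linear presalg K I rel -> M} :=
  HB.pack f (GRing.isLinear.Build K (presalg K I rel) M *:%R f f_lin).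
by exists fl => x; exact: proj.
Qed.

End PresentedMaps.

(** * Functionals on T(V) # G *)

Section Twist.
Variables (K : fieldType) (n : nat) (gT : finGroupType).
Variable rho : mx_representation K [set: gT]%G n.
Variable M : lmodType K.
Implicit Types (g h : gT) (u v w : seq 'I_n) (F : seq 'I_n -> M).

(* Words stand for elements of the tensor algebra T(V), and F for a linear map
   on it: twist g w F is the value of F at g(w). *)
Fixpoint twist g w F : M :=
  if w is i :: w' then \sum_j rho g j i *: twist g w' (fun u => F (j :: u))
  else F [::].

Lemma twist_cat g u v F :
  twist g (u ++ v) F = twist g u (fun a => twist g v (fun b => F (a ++ b))).
Proof.
elim: u F => [//|i u IHu] F /=.
by apply: eq_bigr => j _; rewrite IHu.
Qed.

Lemma eq_twist g w F F' : (forall u, size u = size w -> F u = F' u) ->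
  twist g w F = twist g w F'.
Proof.
elim: w F F' => [|i w IHw] F F' FF' /=; first exact: FF'.
apply: eq_bigr => j _; congr (_ *: _); apply: IHw => u Su.
by apply: FF'; rewrite /= Su.
Qed.

Lemma twistD g w F F' :
  twist g w (fun u => F u + F' u) = twist g w F + twist g w F'.
Proof.
elim: w F F' => [//|i w IHw] F F' /=.
by rewrite -big_split; apply: eq_bigr => j _; rewrite IHw scalerDr.
Qed.

Lemma twistZ g w a F : twist g w (fun u => a *: F u) = a *: twist g w F.
Proof.
elim: w F => [//|i w IHw] F /=.
by rewrite scaler_sumr; apply: eq_bigr => j _; rewrite IHw !scalerA mulrC.
Qed.

Lemma twist0 g w : twist g w (fun=> 0) = 0.
Proof.
by elim: w => [//|i w IHw] /=; rewrite big1 // => j _; rewrite IHw scaler0.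
Qed.

Lemma twistB g w F F' :
  twist g w (fun u => F u - F' u) = twist g w F - twist g w F'.
Proof.
rewrite -[- twist _ _ F']scaleN1r -twistZ -twistD.
by apply: eq_twist => u _; rewrite scaleN1r.
Qed.

Lemma twist_sum (T : Type) (r : seq T) g w (F : T -> seq 'I_n -> M) :
  twist g w (fun u => \sum_(i <- r) F i u) = \sum_(i <- r) twist g w (F i).
Proof.
elim: r => [|i r IHr].
  by rewrite big_nil -[RHS](twist0 g w); apply: eq_twist => u _; rewrite big_nil.
by rewrite big_cons -IHr -twistD; apply: eq_twist => u _; rewrite big_cons.
Qed.

Lemma twist_exchange g h u v (F : seq 'I_n -> seq 'I_n -> M) :
  twist g u (fun a => twist h v (F a)) = twist h v (fun b => twist g u (F ^~ b)).
Proof.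
elim: u F => [//|i u IHu] F /=; rewrite twist_sum.
by apply: eq_bigr => j _; rewrite twistZ IHu.
Qed.

(** The inner twist is applied to the letters already transformed by h, so the matrices multiply to
    that of g h. *)
Lemma twist_mul g h w F :
  twist h w (fun u => twist g u F) = twist (g * h)%g w F.
Proof.
elim: w F => [//|i w IHw] F /=.
under eq_bigr => j _.
  rewrite twist_sum scaler_sumr.
  under eq_bigr => k _ do rewrite twistZ IHw scalerA.
  over.
rewrite exchange_big /=; apply: eq_bigr => k _.
rewrite -scaler_suml repr_mxM ?inE // mxE; congr (_ *: _).
by apply: eq_bigr => j _; rewrite mulrC.
Qed.

Lemma twist_id w F : twist 1%g w F = F w.
Proof.
elim: w F => [//|i w IHw] F /=.
rewrite repr_mx1 (bigD1 i) //= big1 ?addr0 => [|j /negPf ji].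
  by rewrite !mxE eqxx scale1r IHw.
by rewrite !mxE ji scale0r.
Qed.

End Twist.

(** * Descents and inversions of words *)

Section Descents.
Variable n : nat.
Implicit Types (u v w : seq 'I_n) (i j : 'I_n).
Local Notation word := (seq 'I_n).

(** Choosing the leftmost descent makes the reduction of a word deterministic; [confluence] shows
    that any other descent gives the same value. *)
Fixpoint descent w : option (word * 'I_n * 'I_n * word) :=
  if w is i :: ((j :: v) as w') then
    if (j < i)%N then Some ([::], i, j, v)
    else if descent w' is Some (u, a, b, v') then Some (i :: u, a, b, v') else None
  else None.

Fixpoint inversions w : nat :=
  if w is i :: w' then (count (fun j : 'I_n => j < i)%N w' + inversions w')%N else 0.

Definition ord_leq i j := (i <= j)%N.

Lemma descent_cons i j v : descent (i :: j :: v) =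
  if (j < i)%N then Some ([::], i, j, v)
  else if descent (j :: v) is Some (u, a, b, v') then Some (i :: u, a, b, v')
  else None.
Proof. by []. Qed.

Lemma descentP w u j i v : descent w = Some (u, j, i, v) ->
  w = u ++ [:: j, i & v] /\ (i < j)%N.
Proof.
elim: w u => [//|a [//|b w] IHw] u; rewrite descent_cons.
case: ifP => [ba [<- <- <- <-] //|_].
case E: descent => [[[[u' a'] b'] v']|//] [<- ? ? ?]; subst.
by have [-> ?] := IHw _ E.
Qed.

Lemma descentN w : descent w = None <-> sorted ord_leq w.
Proof.
elim: w => [//|a [//|b w] IHw]; rewrite descent_cons.
have -> : sorted ord_leq [:: a, b & w] = (a <= b)%N && sorted ord_leq (b :: w) by [].
rewrite [(a <= b)%N]leqNgt; case: ifP => // _; rewrite andTb -IHw.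
by case: (descent (b :: w)) => [[[[? ?] ?] ?]|].
Qed.

Lemma descent_exists u j i v : (i < j)%N -> descent (u ++ [:: j, i & v]) <> None.
Proof.
move=> ij /descentN.
have ji : ord_leq j i = false by rewrite /ord_leq leqNgt ij.
by rewrite /sorted; case: u => [|a u] /=; rewrite ?cat_path /= ji ?andbF.
Qed.

(** Only the swapped pair changes its relative order. The count serves as the inner induction
    measure. *)
Lemma inversions_swap u j i v : (i < j)%N ->
  inversions (u ++ [:: j, i & v]) = (inversions (u ++ [:: i, j & v])).+1.
Proof.
move=> ij; elim: u => [|a u IHu] /=.
  by rewrite ij ltnNge (ltnW ij) /=; lia.
by rewrite IHu !count_cat /=; lia.
Qed.

End Descents.

Section Functionals.
Variables (K : fieldType) (n : nat) (gT : finGroupType).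
Variable rho : mx_representation K [set: gT]%G n.
Variables (q : 'M[K]_n) (kap : 'I_n -> 'I_n -> grpalg K gT).
Variable M : lmodType K.
Implicit Types (g h : gT) (u v w : seq 'I_n) (i j a b c : 'I_n).
Implicit Types Th : seq 'I_n -> gT -> M.

(* A map Th : seq 'I_n -> gT -> M is a linear map on T(V) # G, with value
   Th w h at w t_h; shift u Th and tact g Th are its compositions with the left
   multiplications by u and t_g.  It factors through H_{Q,kappa} when all its
   defects vanish. *)
Definition shift u Th : seq 'I_n -> gT -> M := fun w h => Th (u ++ w) h.

Definition tact g Th : seq 'I_n -> gT -> M :=
  fun w h => twist rho g w (fun u => Th u (g * h)%g).

(** The value of [Th] at kappa(v_i, v_j) v t_h, where each t_g has been moved to the right of v. *)
Definition corr Th i j v h : M := \sum_g kap i j g *: tact g Th v h.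

(** The value of [Th] at the relator v_j v_i - q_ij v_i v_j - kappa(v_i, v_j), multiplied by u on
    the left and by v t_h on the right. *)
Definition defect Th u j i v h : M :=
  Th (u ++ [:: j, i & v]) h -
  (q i j *: Th (u ++ [:: i, j & v]) h + corr (shift u Th) i j v h).

(** If v_a v_b occurs in g(v_j) g(v_i), then its commutation parameter q_ba equals q_ij. *)
Definition stable_params := forall g a b i j,
  rho g a j * rho g b i * q i j = rho g a j * rho g b i * q b a.

(** The coefficient of t_k in the invariance condition kappa(g v_i, g v_j) = t_g kappa(v_i, v_j)
    t_g^-1, with kappa extended bilinearly. *)
Definition stable_form := forall g k i j,
  \sum_a \sum_b rho g a j * rho g b i * kap b a k = kap i j (g^-1 * k * g)%g.

Lemma eq_corr Th Th' i j v h :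
    (forall w g, size w = size v -> Th w g = Th' w g) ->
  corr Th i j v h = corr Th' i j v h.
Proof.
move=> E; apply: eq_bigr => g _; congr (_ *: _).
by apply: eq_twist => u Su; exact: E.
Qed.

(** Kept as an explicit error term: it is zero in [defect_tact], and its vanishing is deduced from
    independence in [pbw_stable_form]. *)
Definition form_defect g k i j : K :=
  \sum_a \sum_b rho g a j * rho g b i * kap b a k - kap i j (g^-1 * k * g)%g.

(* The action of t_g maps relations to relations, up to the failure of the form
   kap to be invariant. *)
Lemma defect_tact_form Th g u j i v h : stable_params ->
  defect (tact g Th) u j i v h = twist rho g u (fun u' =>
    \sum_a \sum_b (rho g a j * rho g b i) *:
       twist rho g v (fun v' => defect Th u' a b v' (g * h)%g))
  + \sum_k form_defect g k i j *: twist rho g u (fun u' =>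
      twist rho (k * g)%g v (fun v' => Th (u' ++ v') (k * g * h)%g)).
Proof.
move=> Hq; rewrite [LHS]/defect.
have -> : tact g Th (u ++ [:: j, i & v]) h = twist rho g u (fun u' =>
    \sum_a \sum_b (rho g a j * rho g b i) *:
       twist rho g v (fun v' => Th (u' ++ [:: a, b & v']) (g * h)%g)).
  rewrite /tact twist_cat; apply: eq_twist => u' _ /=.
  apply: eq_bigr => a _; rewrite scaler_sumr.
  by apply: eq_bigr => b _; rewrite scalerA.
have -> : q i j *: tact g Th (u ++ [:: i, j & v]) h = twist rho g u (fun u' =>
    \sum_a \sum_b (rho g a j * rho g b i) *:
       twist rho g v (fun v' => q b a *: Th (u' ++ [:: b, a & v']) (g * h)%g)).
  rewrite /tact twist_cat -twistZ; apply: eq_twist => u' _ /=.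
  rewrite scaler_sumr; under [LHS]eq_bigr => b _ do rewrite !scaler_sumr.
  rewrite exchange_big /=; apply: eq_bigr => a _; apply: eq_bigr => b _.
  rewrite twistZ !scalerA -Hq; congr (_ *: _); ring.
pose S k := twist rho g u (fun u' =>
  twist rho (k * g)%g v (fun v' => Th (u' ++ v') (k * g * h)%g)).
have corrL : corr (shift u (tact g Th)) i j v h =
    \sum_k kap i j (g^-1 * k * g)%g *: S k.
  (* Moving t_g past t_k turns k into g k g^-1, whence the reindexing. *)
  rewrite [RHS](reindex_inj (conjg_inj g^-1%g)) /=; apply: eq_bigr => k _.
  rewrite /S conjgE invgK !mulgA mulVg mul1g !mulgKV; congr (_ *: _).
  rewrite /tact /shift; under eq_twist => w _ do rewrite twist_cat.
  rewrite -twist_exchange; apply: eq_twist => u' _.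
  by rewrite twist_mul; apply: eq_twist => v' _; rewrite mulgA.
have corrR : twist rho g u (fun u' => \sum_a \sum_b (rho g a j * rho g b i) *:
      twist rho g v (fun v' => corr (shift u' Th) b a v' (g * h)%g)) =
    \sum_k (\sum_a \sum_b rho g a j * rho g b i * kap b a k) *: S k.
  rewrite /S; under [RHS]eq_bigr => k _ do rewrite -twistZ.
  rewrite -twist_sum; apply: eq_twist => u' _.
  under [RHS]eq_bigr => k _ do rewrite scaler_suml.
  rewrite [RHS]exchange_big; apply: eq_bigr => a _ /=.
  under [RHS]eq_bigr => k _ do rewrite scaler_suml.
  rewrite [RHS]exchange_big; apply: eq_bigr => b _ /=.
  rewrite twist_sum scaler_sumr; apply: eq_bigr => k _.
  by rewrite twistZ twist_mul scalerA /shift mulgA.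
have corrS : \sum_k form_defect g k i j *: S k =
    \sum_k (\sum_a \sum_b rho g a j * rho g b i * kap b a k) *: S k
    - \sum_k kap i j (g^-1 * k * g)%g *: S k.
  by rewrite -sumrB; apply: eq_bigr => k _; rewrite -scalerBl.
rewrite corrL; apply: etrans _ (congr1 (+%R _) (esym corrS)).
rewrite -corrR addrA opprD addrA; congr (_ - _).
rewrite -!twistB -twistD; apply: eq_twist => u' _.
rewrite -!sumrB -big_split; apply: eq_bigr => a _ /=.
rewrite -!sumrB -big_split; apply: eq_bigr => b _ /=.
rewrite -scalerBr -scalerDr -twistB -twistD; congr (_ *: _).
by apply: eq_twist => v' _; rewrite /defect opprD addrA subrK.
Qed.

Lemma defect_tact Th g u j i v h : stable_params -> stable_form ->
  defect (tact g Th) u j i v h = twist rho g u (fun u' =>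
    \sum_a \sum_b (rho g a j * rho g b i) *:
       twist rho g v (fun v' => defect Th u' a b v' (g * h)%g)).
Proof.
move=> Hq Hk; rewrite defect_tact_form // [X in _ + X]big1 ?addr0 // => k _.
by rewrite /form_defect Hk subrr scale0r.
Qed.

Definition good Th := forall u j i v h, defect Th u j i v h = 0.

Lemma corr_shift Th x u i j v h :
  corr (shift u (shift x Th)) i j v h = corr (shift (x ++ u) Th) i j v h.
Proof. by apply: eq_corr => w g _; rewrite /shift catA. Qed.

Lemma good_shift Th x : good Th -> good (shift x Th).
Proof.
move=> goodTh u j i v h; rewrite -[RHS](goodTh (x ++ u) j i v h).
by rewrite /defect corr_shift /shift !catA.
Qed.

Lemma good_tact Th g : stable_params -> stable_form ->
  good Th -> good (tact g Th).
Proof.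
move=> Hq Hk goodTh u j i v h; rewrite defect_tact //.
rewrite -[RHS](twist0 rho M g u); apply: eq_twist => u' _.
rewrite big1 // => a _; rewrite big1 // => b _.
rewrite -[RHS](scaler0 _ (rho g a j * rho g b i)) -(twist0 rho M g v).
by congr (_ *: _); apply: eq_twist => v' _; exact: goodTh.
Qed.

Lemma defectE Th u j i v h : defect Th u j i v h = 0 ->
  Th (u ++ [:: j, i & v]) h =
  q i j *: Th (u ++ [:: i, j & v]) h + corr (shift u Th) i j v h.
Proof. by move/subr0_eq. Qed.

(** * The quantum Jacobi identity and local confluence *)

Section QuantumForm.
Hypotheses (hq : quantum_system q) (hkap : quantum_2form q kap).

Lemma defect_diag Th u i v h : defect Th u i i v h = 0.
Proof.
have [[_ qii _] [kii _]] := (hq, hkap).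
rewrite /defect qii scale1r /corr big1 ?addr0 ?subrr // => g _.
by rewrite kii ffunE scale0r.
Qed.

(** The relators for (i, j) and (j, i) are proportional because kappa is a quantum 2-form. With
    [defect_diag], only the relations with i < j remain to be checked. *)
Lemma defect_sym Th u i j v h : i != j ->
  defect Th u i j v h = - (q i j)^-1 *: defect Th u j i v h.
Proof.
move=> ij; have [[qn0 _ qinv] [_ kapC]] := (hq, hkap).
have -> : defect Th u i j v h = Th (u ++ [:: i, j & v]) h -
    ((q i j)^-1 *: Th (u ++ [:: j, i & v]) h
     - (q i j)^-1 *: corr (shift u Th) i j v h).
  rewrite /defect (qinv j i); congr (_ - (_ + _)).
  rewrite /corr -scaleNr scaler_sumr; apply: eq_bigr => g _.
  by rewrite kapC // scalerA.
by rewrite /defect scaleNr scalerBr scalerDr scalerA mulVf // scale1r !opprB addrA.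
Qed.

(* The coefficient of v_l t_g in the quantum Jacobi identity for v_c v_b v_a. *)
Definition jac a b c g l : K :=
  (q b c * q a c * kap a b g * rho g l c
   + q b c * kap a c g * (l == b)%:R + kap b c g * rho g l a)
  - (q a b * q a c * kap b c g * (l == a)%:R
     + q a b * kap a c g * rho g l b + kap a b g * (l == c)%:R).

(** Distinct indices, as in [is_cocycle], where the coboundary is tested on products of distinct
    generators. *)
Definition jacobi := forall a b c g l,
  a != b -> b != c -> a != c -> jac a b c g l = 0.

(** Every correction is a combination of the values of [Th] at x v_l t_g z t_h. A letter v_k to the
    right of t_g contributes rho_lk, a letter to its left a Kronecker delta; collecting coefficients
    gives [jac]. *)
Lemma jac_sum Th x a b c z h :
  (q b c * q a c) *: corr (shift x Th) a b (c :: z) h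
  + q b c *: corr (shift (x ++ [:: b]) Th) a c z h
  + corr (shift x Th) b c (a :: z) h =
  (q a b * q a c) *: corr (shift (x ++ [:: a]) Th) b c z h
  + q a b *: corr (shift x Th) a c (b :: z) h
  + corr (shift (x ++ [:: c]) Th) a b z h
  + \sum_g \sum_l jac a b c g l *:
      twist rho g z (fun z' => Th (x ++ l :: z') (g * h)%g).
Proof.
pose T g l := twist rho g z (fun z' => Th (x ++ l :: z') (g * h)%g).
pose lin F := \sum_g \sum_l F g l *: T g l.
have linD F F' : lin F + lin F' = lin (fun g l => F g l + F' g l).
  rewrite /lin -big_split; apply: eq_bigr => g _ /=.
  by rewrite -big_split; apply: eq_bigr => l _; rewrite scalerDl.
have linZ s F : s *: lin F = lin (fun g l => s * F g l).
  rewrite /lin scaler_sumr; apply: eq_bigr => g _ /=.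
  by rewrite scaler_sumr; apply: eq_bigr => l _; rewrite scalerA.
have corr_cons i j k : corr (shift x Th) i j (k :: z) h =
    lin (fun g l => kap i j g * rho g l k).
  apply: eq_bigr => g _; rewrite /tact /= scaler_sumr.
  by apply: eq_bigr => l _; rewrite scalerA.
have corr_rcons i j k : corr (shift (x ++ [:: k]) Th) i j z h =
    lin (fun g l => kap i j g * (l == k)%:R).
  apply: eq_bigr => g _; rewrite (bigD1 k) //= eqxx mulr1 big1 ?addr0.
    by congr (_ *: _); apply: eq_twist => z' _; rewrite /shift -catA.
  by move=> l /negPf ->; rewrite mulr0 scale0r.
rewrite !(corr_cons, corr_rcons) -/(lin (fun g l => jac a b c g l)) !(linZ, linD).
by apply: eq_bigr => g _; apply: eq_bigr => l _; congr (_ *: _); rewrite /jac; ring.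
Qed.

(* The two ways of reordering v_c v_b v_a, after the first step. *)
Lemma triple_left Th x a b c z h :
    defect Th (x ++ [:: b]) c a z h = 0 -> defect Th x b a (c :: z) h = 0 ->
  q b c *: Th (x ++ [:: b, c, a & z]) h + corr (shift x Th) b c (a :: z) h =
  (q b c * q a c * q a b) *: Th (x ++ [:: a, b, c & z]) h +
  ((q b c * q a c) *: corr (shift x Th) a b (c :: z) h
  + q b c *: corr (shift (x ++ [:: b]) Th) a c z h
  + corr (shift x Th) b c (a :: z) h).
Proof.
move=> /defectE; rewrite -!catA /= => -> /defectE ->.
by rewrite !scalerDr !scalerA !addrA.
Qed.

Lemma triple_right Th x a b c z h :
    defect Th x c a (b :: z) h = 0 -> defect Th (x ++ [:: a]) c b z h = 0 ->
  q a b *: Th (x ++ [:: c, a, b & z]) h + corr (shift (x ++ [:: c]) Th) a b z h =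
  (q b c * q a c * q a b) *: Th (x ++ [:: a, b, c & z]) h +
  ((q a b * q a c) *: corr (shift (x ++ [:: a]) Th) b c z h
  + q a b *: corr (shift x Th) a c (b :: z) h
  + corr (shift (x ++ [:: c]) Th) a b z h).
Proof.
move=> /defectE -> /defectE; rewrite -!catA /= => ->.
rewrite !scalerDr !scalerA !addrA; congr (_ *: _ + _ + _ + _); ring.
Qed.

(** The word v_c v_b v_a is reordered starting from either adjacent pair. The multiples of v_a v_b
    v_c cancel, and [jac_sum] leaves the Jacobi expression. *)
Lemma good_jac Th a b c : good Th ->
  \sum_g \sum_l jac a b c g l *: Th [:: l] g = 0.
Proof.
move=> goodTh; pose h : gT := 1%g.
have := defectE (goodTh [::] c b [:: a] h).
rewrite (defectE (goodTh [:: c] b a [::] h)).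
rewrite (triple_left (goodTh [:: b] c a [::] h) (goodTh [::] b a [:: c] h)).
rewrite (triple_right (goodTh [::] c a [:: b] h) (goodTh [:: a] c b [::] h)).
move=> /addrI; rewrite jac_sum => /eqP.
rewrite eq_sym -subr_eq0 addrAC subrr add0r => /eqP E.
rewrite -[RHS]E; apply: eq_bigr => g _; apply: eq_bigr => l _.
by rewrite mulg1.
Qed.

(** Two overlapping descents. The four vanishing defects carry both reorderings on to v_a v_b v_c,
    and the Jacobi identity equates their accumulated corrections. *)
Lemma near_confluence Th x a b c z h :
    a != b -> b != c -> a != c -> jacobi ->
    defect Th (x ++ [:: b]) c a z h = 0 -> defect Th x b a (c :: z) h = 0 ->
    defect Th x c a (b :: z) h = 0 -> defect Th (x ++ [:: a]) c b z h = 0 ->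
  q b c *: Th (x ++ [:: b, c, a & z]) h + corr (shift x Th) b c (a :: z) h =
  q a b *: Th (x ++ [:: c, a, b & z]) h + corr (shift (x ++ [:: c]) Th) a b z h.
Proof.
move=> ab bc ac HJ Dca Dba Dca' Dcb.
rewrite triple_left // triple_right // jac_sum [X in _ + (_ + X)]big1 ?addr0 // => g _.
by rewrite big1 // => l _; rewrite HJ // scale0r.
Qed.

(** Two disjoint descents. The swaps commute; each correction is reordered at the other pair, where
    words are shorter by two and [small] applies. Both sides then contain the same double correction
    in kap i j and kap k l. *)
Lemma far_confluence Th x i j y k l z h :
    stable_params -> stable_form ->
    (forall u j i v g, (size u + size v <= size x + size y + size z)%N ->
       defect Th u j i v g = 0) ->
    defect Th (x ++ [:: i, j & y]) l k z h = 0 ->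
    defect Th x j i (y ++ [:: k, l & z]) h = 0 ->
  q i j *: Th (x ++ [:: i, j & y ++ [:: l, k & z]]) h
  + corr (shift x Th) i j (y ++ [:: l, k & z]) h =
  q k l *: Th (x ++ [:: j, i & y ++ [:: k, l & z]]) h
  + corr (shift (x ++ [:: j, i & y]) Th) k l z h.
Proof.
move=> Hq Hk small.
(* The pair l k stands to the right of the t_g created by the first correction, so reordering it
   uses stability under G. *)
have inner : corr (shift x Th) i j (y ++ [:: l, k & z]) h =
    q k l *: corr (shift x Th) i j (y ++ [:: k, l & z]) h
    + \sum_g kap i j g *: corr (shift y (tact g (shift x Th))) k l z h.
  rewrite /corr scaler_sumr -big_split; apply: eq_bigr => g _ /=.
  rewrite scalerA mulrC -scalerA -scalerDr; congr (_ *: _).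
  apply: defectE; rewrite defect_tact //.
  rewrite -[RHS](twist0 rho M g y); apply: eq_twist => y' Sy.
  rewrite big1 // => a _; rewrite big1 // => b _.
  rewrite -[RHS](scaler0 _ (rho g a l * rho g b k)) -(twist0 rho M g z).
  congr (_ *: _); apply: eq_twist => z' Sz.
  rewrite /defect corr_shift /shift !catA; apply: small.
  by rewrite size_cat Sy Sz.
(* Here the pair j i stands to the left of the new t_g and is reordered directly. *)
have outer : corr (shift (x ++ [:: j, i & y]) Th) k l z h =
    q i j *: corr (shift (x ++ [:: i, j & y]) Th) k l z h
    + \sum_g kap i j g *: corr (shift y (tact g (shift x Th))) k l z h.
  transitivity (\sum_g kap k l g *: (q i j *: tact g (shift (x ++ [:: i, j & y]) Th) z h
    + \sum_m kap i j m *: tact g (shift y (tact m (shift x Th))) z h)).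
    apply: eq_bigr => g _; congr (_ *: _).
    rewrite /tact -twistZ.
    under [in RHS]eq_bigr => m _ do rewrite -twistZ.
    rewrite -twist_sum -twistD; apply: eq_twist => z' Sz.
    rewrite /shift -!catA /=; apply: defectE; apply: small.
    by rewrite size_cat Sz addnA.
  rewrite /corr scaler_sumr.
  under [X in _ = _ + X]eq_bigr => m _ do rewrite scaler_sumr.
  rewrite exchange_big -big_split; apply: eq_bigr => g _ /=.
  rewrite scalerDr !scalerA mulrC scaler_sumr; congr (_ + _).
  by apply: eq_bigr => m _; rewrite !scalerA mulrC.
move=> /defectE; rewrite -!catA /= => -> /defectE ->.
rewrite inner outer !scalerDr !scalerA [q k l * _]mulrC.
by rewrite !addrA; congr (_ + _); rewrite addrAC.
Qed.
End QuantumForm.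

(** * Extension of functionals from sorted words *)

Section Existence.
Variable E : seq 'I_n -> gT -> M.

(* Values on words shorter by two are read off P; k bounds the number of
   inversions. *)
Fixpoint reduce (P : seq 'I_n -> gT -> M) k w h : M :=
  if descent w is Some (u, j, i, v) then
    if k is k'.+1 then
      q i j *: reduce P k' (u ++ [:: i, j & v]) h + corr (shift u P) i j v h
    else 0
  else E w h.

(** The fuel [d] bounds the length of the word; each level reads its corrections from the level
    below. *)
Fixpoint extend d : seq 'I_n -> gT -> M :=
  if d is d'.+1 then fun w => reduce (extend d') (inversions w) w else E.

Definition extension w h := extend (size w) w h.

Lemma reduceE P k w h : reduce P k w h =
  if descent w is Some (u, j, i, v) then
    if k is k'.+1 then
      q i j *: reduce P k' (u ++ [:: i, j & v]) h + corr (shift u P) i j v h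
    else 0
  else E w h.
Proof. by case: k. Qed.

(** Swaps preserve the length and [P] is read only in corrections, hence only at words shorter by
    two. *)
Lemma eq_reduce P P' k w h :
    (forall w' g, (size w').+2 = size w -> P w' g = P' w' g) ->
  reduce P k w h = reduce P' k w h.
Proof.
elim: k w => [|k IHk] w PP'; rewrite 2!reduceE; case Ew: descent => [[[[u j] i] v]|] //.
have [Dw _] := descentP Ew; congr (_ *: _ + _).
  by apply: IHk => w' g Sw'; apply: PP'; rewrite Sw' Dw !size_cat.
apply: eq_corr => w' g Sw'; rewrite /shift; apply: PP'.
by rewrite Dw !size_cat Sw' /= !addnS.
Qed.

Lemma extend_stable d w h : (size w <= d)%N -> extend d w h = extension w h.
Proof.
suff step e v g : (size v <= e)%N -> extend e.+1 v g = extend e v g.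
  rewrite /extension => /subnKC <-; elim: (d - _)%N => [|m IHm]; first by rewrite addn0.
  by rewrite addnS step ?leq_addr.
elim: e v g => [|e IHe] v g Sv.
  by rewrite leqn0 in Sv; rewrite /= reduceE (size0nil (eqP Sv)).
by apply: eq_reduce => v' k Sv'; apply: IHe; rewrite -ltnS (leq_trans _ Sv) // -Sv'.
Qed.

(** Each swap removes one inversion, so with their number as fuel the default value 0 of [reduce] is
    never reached; [extend_stable] handles the shorter words in the correction. *)
Lemma extensionE w h : extension w h =
  if descent w is Some (u, j, i, v) then
    q i j *: extension (u ++ [:: i, j & v]) h + corr (shift u extension) i j v h
  else E w h.
Proof.
rewrite {1}/extension; case Sw: (size w) => [|d] /=.
  by rewrite (size0nil Sw).
rewrite reduceE; case Ew: descent => [[[[u j] i] v]|//].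
have [Dw ij] := descentP Ew; rewrite {1}Dw inversions_swap //.
have Sw' : size (u ++ [:: i, j & v]) = d.+1 by rewrite -Sw Dw !size_cat.
congr (_ *: _ + _); first by rewrite /extension Sw'.
apply: eq_corr => w' g Sv; rewrite /shift; apply: extend_stable.
by move: Sw'; rewrite !size_cat Sv /=; lia.
Qed.

Hypotheses (hq : quantum_system q) (hkap : quantum_2form q kap).
Hypotheses (Hq : stable_params) (Hk : stable_form).
Hypothesis HJ : jacobi.

Lemma catP u1 s1 u2 s2 : u1 ++ s1 = u2 ++ s2 :> seq 'I_n -> (size u1 <= size u2)%N ->
  exists2 t, u2 = u1 ++ t & s1 = t ++ s2.
Proof.
elim: u1 u2 => [|a u1 IHu] [|b u2] //=; first by move=> ->; exists [::].
  by move=> ->; exists (b :: u2).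
by case=> <- /IHu + S12 => /(_ S12)[t -> ->]; exists t.
Qed.

(** The part of u2 beyond u1 is empty, one letter, or longer: the descents coincide, overlap
    ([near_confluence]) or are disjoint ([far_confluence]). *)
Lemma confluence Th u1 j1 i1 v1 u2 j2 i2 v2 h :
    (i1 < j1)%N -> (i2 < j2)%N -> u1 ++ [:: j1, i1 & v1] = u2 ++ [:: j2, i2 & v2] ->
    (forall u j i v g, (size u + size v < size u1 + size v1)%N ->
       defect Th u j i v g = 0) ->
    (forall u j i v g, (i < j)%N -> size u + size v = (size u1 + size v1)%N ->
       (inversions (u ++ [:: j, i & v]) < inversions (u1 ++ [:: j1, i1 & v1]))%N ->
       defect Th u j i v g = 0) ->
  q i1 j1 *: Th (u1 ++ [:: i1, j1 & v1]) h + corr (shift u1 Th) i1 j1 v1 h =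
  q i2 j2 *: Th (u2 ++ [:: i2, j2 & v2]) h + corr (shift u2 Th) i2 j2 v2 h.
Proof.
wlog S12 : u1 j1 i1 v1 u2 j2 i2 v2 / (size u1 <= size u2)%N => [wl|].
  move=> ij1 ij2 E12 small less.
  have S : (size u1 + size v1 = size u2 + size v2)%N.
    by move/(congr1 size): E12; rewrite !size_cat /=; lia.
  case: (leqP (size u1) (size u2)) => [/wl|/ltnW/wl] H; first exact: H.
  symmetry; apply: H => //; first by move=> *; apply: small; rewrite S.
  by move=> u j i v g ij Suv I12; apply: less; rewrite ?S ?E12.
move=> ij1 ij2 E12 small less.
have [[|a [|b y]] Du2] := catP E12 S12; rewrite /= ?cats0 in Du2 *.
- by rewrite Du2; case=> -> -> ->.
- case=> Ej Ei Ev; subst j1 i1 v1 u2 => {E12 S12}.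
  have ne i j : (i < j)%N -> i != j by move=> ij; rewrite -(inj_eq val_inj) /= (ltn_eqF ij).
  have lt := inversions_swap u1 (i2 :: v2) ij1.
  have lt' : inversions (u1 ++ [:: a, j2, i2 & v2]) =
      (inversions (u1 ++ [:: a, i2, j2 & v2])).+1.
    by have := inversions_swap (u1 ++ [:: a]) v2 ij2; rewrite -!catA.
  have ij := ltn_trans ij2 ij1.
  have ltb : (inversions (u1 ++ [:: j2, i2, a & v2])).+1 =
      inversions (u1 ++ [:: j2, a, i2 & v2]).
    by have := inversions_swap (u1 ++ [:: j2]) v2 ij; rewrite -!catA.
  have lta := inversions_swap u1 (j2 :: v2) ij.
  rewrite -[(u1 ++ _) ++ _]catA /=.
  (* The four intermediate words in sorting the decreasing triple a, j2, i2 all have fewer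
     inversions than the original word. *)
  apply: near_confluence; rewrite ?ne //; apply: less => //.
  + by rewrite size_cat /=; lia.
  + by rewrite -catA /=; lia.
  + by rewrite /=; lia.
  + by rewrite /=; lia.
  + by rewrite size_cat /=; lia.
  + rewrite -catA /=. lia.
case=> ? ? ?; subst => {E12 S12}.
rewrite -!catA /=; apply: far_confluence => //.
- move=> u j i v g S; apply: small; move: S; rewrite !size_cat /=; lia.
- apply: less => //; first by rewrite !size_cat /=; lia.
  by rewrite -catA /= (inversions_swap _ _ ij1).
- apply: less => //; first by rewrite !size_cat /=; lia.
  have R s : u1 ++ [:: a, b & y ++ s] = (u1 ++ [:: a, b & y]) ++ s.
    by rewrite -catA.
  by rewrite !R (inversions_swap _ _ ij2).
Qed.

(** By construction the relation holds at the leftmost descent of a word; [confluence] carries it to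
    every other one, by induction on the length and then on the inversions. *)
Lemma extension_good : good extension.
Proof.
suff gd d : forall u j i v h, (size u + size v = d)%N ->
    defect extension u j i v h = 0 by move=> u j i v h; exact: gd.
elim/ltn_ind: d => d IHd.
suff gi k : forall u j i v h, (i < j)%N -> (size u + size v = d)%N ->
    inversions (u ++ [:: j, i & v]) = k -> defect extension u j i v h = 0.
  move=> u j i v h S; case: (ltngtP i j) => [ij|ji|/val_inj ->].
  - exact: gi S erefl.
  - rewrite defect_sym //; first by rewrite (gi _ _ _ _ _ _ ji S erefl) scaler0.
    by rewrite -(inj_eq val_inj) /= (ltn_eqF ji).
  - exact: defect_diag.
elim/ltn_ind: k => k IHk u j i v h ij S I.
apply/eqP; rewrite /defect subr_eq0; apply/eqP.
rewrite extensionE; case Ew: descent => [[[[u' j'] i'] v']|]; last first.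
  by case: (descent_exists ij Ew).
have [Dw ij'] := descentP Ew; symmetry; apply: confluence => //.
- by move=> *; apply: IHd; last reflexivity; rewrite -S.
- move=> u0 j0 i0 v0 g ij0 S0; rewrite I => I0.
  exact: (IHk _ I0 _ _ _ _ _ ij0 (etrans S0 S) erefl).
Qed.

Lemma extension_sorted w h : sorted (@ord_leq n) w -> extension w h = E w h.
Proof. by move=> /descentN Ew; rewrite extensionE Ew. Qed.

End Existence.

End Functionals.

(** * Functionals on the Hecke algebra and its basis *)

HB.lock Definition fcomb (K : fieldType) (L : choiceType) (I : finType) (c : I -> K)
  (F : I -> seq L) : freealg K L := \sum_i c i *: fword K (F i).

Lemma big_option (V : nmodType) (T : finType) (F : option T -> V) :
  \sum_o F o = F None + \sum_t F (Some t).
Proof.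
rewrite (bigD1 None) //=; congr (_ + _); rewrite (reindex_omap Some id) /=.
  by apply: eq_bigl => t; rewrite eqxx.
by case.
Qed.

Section HeckeFunctionals.
Variables (K : fieldType) (n : nat) (gT : finGroupType).
Variable rho : mx_representation K [set: gT]%G n.
Variables (q : 'M[K]_n) (kap : 'I_n -> 'I_n -> grpalg K gT).
Implicit Types (g h : gT) (w : seq 'I_n) (i j : 'I_n).
Local Notation letter := ('I_n + gT)%type.
Local Notation rel := (hecke_rel rho q kap).
Local Notation H := (hecke rho q kap).

Section Lift.
Variable M : lmodType K.
Implicit Types Th : seq 'I_n -> gT -> M.

(* wact s Th is the functional x |-> Th (s x). *)
Fixpoint wact (s : seq letter) Th : seq 'I_n -> gT -> M :=
  match s with
  | [::] => Th
  | inl i :: s' => wact s' (shift [:: i] Th)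
  | inr g :: s' => wact s' (tact rho g Th)
  end.

Lemma wact_cat s t Th : wact (s ++ t) Th = wact t (wact s Th).
Proof. by elim: s Th => [//|[i|g] s IHs] Th /=. Qed.

Lemma wact_sum (T : Type) (r : seq T) (c : T -> K)
    (F : T -> seq 'I_n -> gT -> M) s w h :
  wact s (fun w h => \sum_(t <- r) c t *: F t w h) w h =
  \sum_(t <- r) c t *: wact s (F t) w h.
Proof.
elim: s F => [//|[j|g] s IHs] F /=; first exact: IHs.
rewrite -(IHs (fun t => tact rho g (F t))); congr (wact s _ w h).
apply/funext => u; apply/funext => k; rewrite /tact twist_sum.
by apply: eq_bigr => t _; rewrite twistZ.
Qed.

Lemma wact_good s Th : stable_params rho q -> stable_form rho kap ->
  good rho q kap Th -> good rho q kap (wact s Th).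
Proof.
move=> Hq Hk; elim: s Th => [//|[i|g] s IHs] Th /= goodTh; apply: IHs.
  exact: good_shift.
exact: good_tact.
Qed.

(** At a relator between words s and t only the functional [wact s Th] matters, which is again good.
    The group relators die by [twist_id] and [twist_mul], the action relator by the definition of
    [tact], the commutation relator by goodness. *)
Lemma hecke_lift Th : stable_params rho q -> stable_form rho kap ->
    good rho q kap Th ->
  exists f : {linear H -> M}, forall s, f (pword rel s) = wact s Th [::] 1%g.
Proof.
move=> Hq Hk goodTh.
have [L LE] := freealg_lift (fun s : seq letter => wact s Th [::] 1%g).
have Lw s t r : L (sandwich s t (fword K r)) = wact t (wact r (wact s Th)) [::] 1%g.
  by rewrite sandwich_fword LE !wact_cat.
have [s t r rr|f fE] := @presalg_lift K _ rel M L; last first.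
  by exists f => s; rewrite fE LE.
have [l [<- lB lsum lword]] : exists l : freealg K _ -> M,
    [/\ l r = L (sandwich s t r), {morph l : x y / x - y},
        forall (I : finType) (c : I -> K) (F : I -> seq letter),
          l (fcomb c F) = \sum_i c i *: l (fword K (F i)) &
        forall x, l (fword K x) = wact t (wact x (wact s Th)) [::] 1%g].
  exists (L \o sandwich s t); split=> // [x y|I c F|x]; last exact: Lw.
    exact: linearB.
  by rewrite fcomb.unlock linear_sum; apply: eq_bigr => i _; exact: linearZ.
have goods := wact_good s Hq Hk goodTh.
move: (wact s Th) goods lword => Ths goods lword {Lw LE L}.
case: rr => [|g h|g x|i j].
- rewrite fgen_fword -fword_nil lB !lword.
  apply/eqP; rewrite subr_eq0; apply/eqP; congr (wact t _ _ _).
  by apply/funext => w; apply/funext => h; rewrite /= /tact twist_id mul1g.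
- rewrite !fgen_fword fwordM lB !lword.
  apply/eqP; rewrite subr_eq0; apply/eqP; congr (wact t _ _ _).
  apply/funext => w; apply/funext => k; rewrite /= /tact twist_mul.
  by apply: eq_twist => u _; rewrite mulgA.
- have -> : fgen K (inr g) * hecke_vec gT x =
      fcomb (fun i => x i ord0) (fun i => [:: inr g; inl i]).
    rewrite fcomb.unlock /hecke_vec mulr_sumr; apply: eq_bigr => i _.
    by rewrite -scalerAr !fgen_fword fwordM.
  have -> : hecke_vec gT (rho g *m x) * fgen K (inr g) =
      fcomb (fun i => (rho g *m x) i ord0) (fun i => [:: inl i; inr g]).
    rewrite fcomb.unlock /hecke_vec mulr_suml; apply: eq_bigr => i _.
    by rewrite -scalerAl !fgen_fword fwordM.
  rewrite lB !lsum.
  under eq_bigr => i _ do rewrite lword.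
  under [X in _ - X]eq_bigr => i _ do rewrite lword.
  rewrite -!wact_sum; apply/eqP; rewrite subr_eq0; apply/eqP; congr (wact t _ _ _).
  apply/funext => w; apply/funext => h; rewrite /shift /tact /=.
  under eq_bigr => i _ do rewrite scaler_sumr.
  rewrite exchange_big; apply: eq_bigr => j _ /=.
  rewrite mxE scaler_suml; apply: eq_bigr => i _.
  by rewrite scalerA mulrC.
(* The reduced side of the relation as one combination: [None] indexes the quadratic term and
   [Some g] the term in t_g. *)
pose c (o : option gT) := if o is Some g then kap i j g else q i j.
pose F (o : option gT) : seq letter := if o is Some g then [:: inr g] else [:: inl i; inl j].
have -> : q i j *: (fgen K (inl i) * fgen K (inl j)) + \sum_g kap i j g *: fgen K (inr g)
    = fcomb c F.
  have -> : \sum_g kap i j g *: fgen K (inr g) =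
      \sum_g c (Some g) *: fword K (F (Some g)).
    by apply: eq_bigr => g _; rewrite fgen_fword.
  by rewrite !fgen_fword fwordM fcomb.unlock big_option.
rewrite !fgen_fword fwordM lB lsum lword.
under eq_bigr => o _ do rewrite lword.
rewrite -wact_sum; apply/eqP; rewrite subr_eq0; apply/eqP; congr (wact t _ _ _).
apply/funext => w; apply/funext => h; rewrite big_option.
exact: defectE (goods [::] j i w h).
Qed.

End Lift.
End HeckeFunctionals.

(** * Spans and bases *)

Section Basis.
Variables (K : fieldType) (V : lmodType K) (B : eqType) (b : B -> V).

(** Repetitions are allowed, so that sums become concatenations; [in_span_family] collects the
    coefficients afterwards. *)
Definition in_span (x : V) := exists r : seq (K * B), x = \sum_(p <- r) p.1 *: b p.2.

Lemma in_span0 : in_span 0.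
Proof. by exists [::]; rewrite big_nil. Qed.

Lemma in_spanD x y : in_span x -> in_span y -> in_span (x + y).
Proof. by move=> [r ->] [s ->]; exists (r ++ s); rewrite big_cat. Qed.

Lemma in_spanZ a x : in_span x -> in_span (a *: x).
Proof.
move=> [r ->]; exists [seq (a * p.1, p.2) | p <- r].
by rewrite big_map scaler_sumr; apply: eq_bigr => p _; rewrite scalerA.
Qed.

Lemma in_span_sum (T : Type) (r : seq T) (F : T -> V) :
  (forall t, in_span (F t)) -> in_span (\sum_(t <- r) F t).
Proof. by move=> spF; elim/big_ind: _ => *; [exact: in_span0 | exact: in_spanD | ]. Qed.

Lemma in_span_gen i : in_span (b i).
Proof. by exists [:: (1, i)]; rewrite big_seq1 scale1r. Qed.

Lemma in_span_family x : in_span x ->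
  exists (s : seq B) (c : B -> K), x = \sum_(i <- s) c i *: b i.
Proof.
move=> [r ->]; exists (undup (map snd r)), (fun i => \sum_(p <- r | p.2 == i) p.1).
under [RHS]eq_bigr => i _ do rewrite scaler_suml.
rewrite (exchange_big_dep xpredT) //= big_seq [RHS]big_seq.
apply: eq_bigr => p pr; rewrite -big_filter.
have -> : [seq i <- undup (map snd r) | p.2 == i] = [:: p.2].
  apply: perm_small_eq => //; apply: uniq_perm => //.
    by rewrite filter_uniq ?undup_uniq.
  move=> i; rewrite mem_filter mem_undup inE eq_sym.
  by case: eqP => // ->; exact: map_f.
by rewrite big_seq1.
Qed.

Lemma is_basis_free (T : finType) (iota : T -> B) (c : T -> K) :
    is_basis b -> injective iota -> \sum_t c t *: b (iota t) = 0 ->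
  forall t, c t = 0.
Proof.
move=> [free_b _] inj_iota c0 t.
(* As [iota] is injective, this is c on its image and zero elsewhere. *)
pose c' i := \sum_(t | iota t == i) c t.
have c'E s : c' (iota s) = c s.
  by rewrite /c' (big_pred1 s) // => s'; rewrite (inj_eq inj_iota).
rewrite -c'E; apply: (free_b (map iota (enum T)) c').
- by rewrite map_inj_uniq ?enum_uniq.
- by rewrite big_map big_enum -[RHS]c0; apply: eq_bigr => s _; rewrite c'E.
- by rewrite map_f ?mem_enum.
Qed.

End Basis.

Lemma twist_linear (K : fieldType) (n : nat) (gT : finGroupType)
    (rho : mx_representation K [set: gT]%G n) (M M' : lmodType K) (f : M -> M')
    g w (F : seq 'I_n -> M) : linear f ->
  twist rho g w (fun u => f (F u)) = f (twist rho g w F).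
Proof.
move=> f_lin.
have fZ := scalable_linear f_lin.
have fD x y : f (x + y) = f x + f y by have := f_lin 1 x y; rewrite !scale1r.
have f0 : f 0 = 0 by rewrite -[0](subrr 0) (zmod_morphism_linear f_lin) subrr.
elim: w F => [//|i w IHw] F /=.
by rewrite (big_morph f fD f0); apply: eq_bigr => j _; rewrite IHw fZ.
Qed.

Lemma quotalg_mulr_linear (K : fieldType) (A : algType K) (rel : A -> Prop)
  (x : quotalg rel) : linear ( *%R x).
Proof. by move=> a y z; rewrite mulrDr quotalg_scalerAr. Qed.

(** * Sorted words and exponent vectors *)

Section SortedWords.
Variable n : nat.

Definition sorted_word (a : {ffun 'I_n -> nat}) : seq 'I_n :=
  flatten [seq nseq (a i) i | i <- enum 'I_n].

Lemma count_sorted_word a i : count_mem i (sorted_word a) = a i.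
Proof.
rewrite count_flatten -map_comp sumnE big_map big_enum (bigD1 i) //= count_nseq.
rewrite /= eqxx mul1n big1 ?addn0 // => j /negPf ji.
by rewrite count_nseq /= ji.
Qed.

Lemma sorted_word_inj : injective sorted_word.
Proof. by move=> a b E; apply/ffunP => i; rewrite -count_sorted_word E count_sorted_word. Qed.

Lemma sorted_wordP a : sorted (@ord_leq n) (sorted_word a).
Proof.
have tr : transitive (@ord_leq n) by move=> y x z; exact: leq_trans.
rewrite sorted_pairwise // /sorted_word.
have : pairwise (@ord_leq n) (enum 'I_n).
  rewrite -sorted_pairwise //.
  by have := iota_sorted 0 n; rewrite -val_enum_ord sorted_map.
elim: (enum _) => [//|i e IHe] /= /andP[ie pe].
rewrite pairwise_cat IHe // andbT; apply/andP; split.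
  apply/allrelP => x y /nseqP[-> _] /flatten_mapP[j je /nseqP[-> _]].
  exact: (allP ie).
by elim: (a i) => //= m ->; rewrite andbT all_nseq /ord_leq leqnn orbT.
Qed.

Lemma sorted_wordK w : sorted (@ord_leq n) w ->
  w = sorted_word [ffun i => count_mem i w].
Proof.
move=> sw; apply: (@sorted_eq _ (@ord_leq n)) => //.
- by move=> y x z; exact: leq_trans.
- by move=> x y /anti_leq/val_inj.
- exact: sorted_wordP.
- by apply/allP => i _ /=; rewrite count_sorted_word ffunE.
Qed.

End SortedWords.

(** * Straightening and the PBW basis *)

HB.lock Definition hword (K : fieldType) (n : nat) (gT : finGroupType)
    (rho : mx_representation K [set: gT]%G n) (q : 'M[K]_n)
    (kap : 'I_n -> 'I_n -> grpalg K gT) (w : seq 'I_n) (g : gT) :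
    hecke rho q kap :=
  pword (hecke_rel rho q kap) (map inl w) * pgen (hecke_rel rho q kap) (inr g).

Section HeckeBasis.
Variables (K : fieldType) (n : nat) (gT : finGroupType).
Variable rho : mx_representation K [set: gT]%G n.
Variables (q : 'M[K]_n) (kap : 'I_n -> 'I_n -> grpalg K gT).
Implicit Types (g h : gT) (w : seq 'I_n) (i j : 'I_n).
Local Notation rel := (hecke_rel rho q kap).
Local Notation H := (hecke rho q kap).
Local Notation T g := (pgen rel (inr g)).
Local Notation X i := (pgen rel (inl i)).

Local Notation hword := (hword rho q kap).

Lemma hword_cons i w g : hword (i :: w) g = X i * hword w g.
Proof. by rewrite hword.unlock /= pword_cons mulrA. Qed.

Lemma hword_nil g : hword [::] g = T g.
Proof. by rewrite hword.unlock /= pword_nil mul1r. Qed.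

Lemma hword_cat u w g : hword (u ++ w) g = pword rel (map inl u) * hword w g.
Proof. by rewrite hword.unlock map_cat pword_cat mulrA. Qed.

Lemma hecke_monomialE (p : {ffun 'I_n -> nat} * gT) :
  hecke_monomial rho q kap p = hword (sorted_word p.1) p.2.
Proof.
rewrite /hecke_monomial hword.unlock; congr (_ * _); rewrite /sorted_word.
transitivity (\prod_(i <- enum 'I_n) X i ^+ p.1 i).
  by rewrite enumT [index_enum 'I_n]unlock.
elim: (enum _) => [|i e IHe] /=; first by rewrite big_nil pword_nil.
rewrite big_cons IHe map_cat pword_cat; congr (_ * _).
elim: (p.1 i) => [|m IHm]; first by rewrite expr0 pword_nil.
by rewrite exprS IHm /= pword_cons.
Qed.

Lemma heckeT1 : T 1%g = 1.
Proof. by apply: qproj_rel; exact: HeckeOne. Qed.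

Lemma heckeTM g h : T g * T h = T (g * h)%g.
Proof. by rewrite /pgen -qprojM; apply: qproj_rel; exact: HeckeMul. Qed.

Lemma hecke_vecE x : qproj rel (hecke_vec gT x) = \sum_i x i ord0 *: X i.
Proof. exact: qproj_gen_sum. Qed.

Lemma heckeTX g i : T g * X i = \sum_j rho g j i *: (X j * T g).
Proof.
have vec_i : X i = qproj rel (hecke_vec gT (delta_mx i ord0)).
  rewrite hecke_vecE (bigD1 i) //= big1 ?addr0 ?mxE ?eqxx ?scale1r //.
  by move=> j /negPf ji; rewrite mxE ji scale0r.
have act x : T g * qproj rel (hecke_vec gT x) =
    qproj rel (hecke_vec gT (rho g *m x)) * T g.
  rewrite -!qprojM; apply: qproj_rel; exact: HeckeAct.
rewrite vec_i act hecke_vecE mulr_suml; apply: eq_bigr => j _.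
rewrite -colE mxE.
exact: esym (quotalg_scalerAl _ _ _).
Qed.

Lemma heckeXX i j :
  X j * X i = q i j *: (X i * X j) + \sum_g kap i j g *: T g.
Proof.
have -> : \sum_g kap i j g *: T g = qproj rel (\sum_g kap i j g *: fgen K (inr g)).
  by symmetry; exact: qproj_gen_sum.
rewrite -!qprojM -qprojZ -qprojD; apply: qproj_rel; exact: HeckeComm.
Qed.

Lemma heckeT_hword g w h : T g * hword w h = tact rho g hword w h.
Proof.
rewrite /tact; elim: w => [|i w IHw] /=; first by rewrite !hword_nil heckeTM.
rewrite hword_cons mulrA heckeTX mulr_suml; apply: eq_bigr => j _.
rewrite -quotalg_scalerAl -mulrA IHw; congr (_ *: _).
rewrite -twist_linear; last exact: quotalg_mulr_linear.
by apply: eq_twist => u _; rewrite hword_cons.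
Qed.

Lemma hword_swap i j v h : hword [:: j, i & v] h =
  q i j *: hword [:: i, j & v] h + \sum_g kap i j g *: tact rho g hword v h.
Proof.
rewrite !hword_cons mulrA heckeXX mulrDl; congr (_ + _).
  by rewrite [X i * (_ * _)]mulrA; exact: esym (quotalg_scalerAl _ _ _).
rewrite mulr_suml; apply: eq_bigr => g _.
by rewrite -heckeT_hword; exact: esym (quotalg_scalerAl _ _ _).
Qed.

(** [hword] is the projection from T(V) # G onto H, seen as a functional with values in H; results
    on good functionals thereby become identities in H. *)
Lemma hword_good : good rho q kap hword.
Proof.
move=> u j i v h; apply/eqP; rewrite subr_eq0; apply/eqP.
rewrite !(hword_cat u) hword_swap mulrDr; congr (_ + _).
  exact: esym (quotalg_scalerAr _ _ _).
rewrite mulr_sumr; apply: eq_bigr => g _.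
have -> : tact rho g (shift u hword) v h =
    pword rel (map inl u) * tact rho g hword v h.
  rewrite /tact -twist_linear; last exact: quotalg_mulr_linear.
  by apply: eq_twist => v' _; rewrite /shift hword_cat.
exact: esym (quotalg_scalerAr _ _ _).
Qed.

Local Notation span := (in_span (hecke_monomial rho q kap)).

Lemma twist_span g w (F : seq 'I_n -> H) :
  (forall u, size u = size w -> span (F u)) -> span (twist rho g w F).
Proof.
elim: w F => [|i w IHw] F spF /=; first exact: spF.
apply: in_span_sum => j; apply: in_spanZ; apply: IHw => u Su.
by apply: spF; rewrite /= Su.
Qed.

(** Straightening: at a descent, the swapped word has one inversion less and the corrections have
    two letters less. *)
Lemma hword_span w g : span (hword w g).
Proof.
move: {2}(size w) (erefl (size w)) => d; elim/ltn_ind: d w g => d IHd w g.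
move: {2}(inversions w) (erefl (inversions w)) => k; elim/ltn_ind: k w g => k IHk w g Ik Sd.
case Dw: (descent w) => [[[[u j] i] v]|]; last first.
  have /sorted_wordK -> : sorted (@ord_leq n) w by apply/descentN.
  by rewrite -[sorted_word _]/(sorted_word (_, g).1) -hecke_monomialE; exact: in_span_gen.
have [Ew ij] := descentP Dw; rewrite Ew (defectE (hword_good u j i v g)).
apply: in_spanD; first apply: in_spanZ.
  apply: (IHk (inversions (u ++ [:: i, j & v]))) => //.
    by rewrite -Ik Ew (inversions_swap _ _ ij).
  by rewrite -Sd Ew !size_cat.
apply: in_span_sum => m; apply: in_spanZ; apply: twist_span => u' Su'.
apply: (IHd (size (u ++ u'))) => //.
by rewrite -Sd Ew !size_cat Su' /=; lia.
Qed.

(** The span contains 1 and is stable under left multiplication by the generators. *)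
Lemma hecke_span x : span x.
Proof.
elim/presalg_ind: x => [||x y Hx Hy|a x Hx|i x [r ->]].
- exact: in_span0.
- by rewrite -heckeT1 -hword_nil; exact: hword_span.
- exact: in_spanD.
- exact: in_spanZ.
rewrite mulr_sumr; apply: in_span_sum => p.
have -> : pgen rel i * (p.1 *: hecke_monomial rho q kap p.2) =
    p.1 *: (pgen rel i * hecke_monomial rho q kap p.2).
  exact: esym (quotalg_scalerAr _ _ _).
rewrite hecke_monomialE; apply: in_spanZ.
case: i => [i|g]; first by rewrite -hword_cons; exact: hword_span.
by rewrite heckeT_hword; apply: twist_span => u _; exact: hword_span.
Qed.

(** Independence comes from dual functionals: for each p, one on H that is 1 at the monomial p and 0
    at all others. *)
Lemma hecke_PBW : quantum_system q -> quantum_2form q kap ->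
    stable_params rho q -> stable_form rho kap -> jacobi rho q kap ->
  quantum_Drinfeld_Hecke rho q kap.
Proof.
move=> hq hkap Hq Hk HJ; split; last by move=> x; exact/in_span_family/hecke_span.
move=> s c us c0 p ps.
(* The values prescribed on sorted words: the indicator of the monomial p. *)
pose E w h : K^o := ((w == sorted_word p.1) && (h == p.2))%:R.
pose Th := extension rho q kap E.
have [f fE] := hecke_lift Hq Hk (extension_good E hq hkap Hq Hk HJ).
have fm p' : f (hecke_monomial rho q kap p') = (p' == p)%:R.
  rewrite hecke_monomialE hword.unlock pgen_pword -pword_cat fE wact_cat.
  have shiftE w t : wact rho (map inl w) t = shift w t :> (seq 'I_n -> gT -> K^o).
    elim: w t => [//|i w IHw] t /=; rewrite IHw; apply/funext => u.
    by apply/funext.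
  rewrite shiftE /= /tact /= /shift cats0 mulg1 extension_sorted ?sorted_wordP //.
  by rewrite /E (inj_eq (@sorted_word_inj n)) -pair_eqE.
have E0 := etrans (esym (linear_comb f s c _)) (etrans (congr1 f c0) (linear0 f)).
have {E0} : \sum_(i <- s) c i *: ((i == p)%:R : K^o) = 0.
  by rewrite -[RHS]E0; apply: eq_bigr => i _; congr (_ *: _); exact: esym (fm i).
rewrite (bigD1_seq p) //= eqxx big1 ?addr0 => [|p' /negPf ->].
  by move=> E0; rewrite -[c p]mulr1.
by rewrite scaler0.
Qed.

End HeckeBasis.

(** * Quantum symmetric and exterior algebras *)

Section QuadraticFunctionals.
Variables (K : fieldType) (n : nat) (q : 'M[K]_n).

Lemma qsym_lift (M : lmodType K) (phi : seq 'I_n -> M) :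
    (forall s t (i j : 'I_n), (i < j)%N ->
       phi (s ++ [:: j; i] ++ t) = q i j *: phi (s ++ [:: i; j] ++ t)) ->
  exists f : {linear qsym q -> M}, forall w, f (pword (qsym_rel q) w) = phi w.
Proof.
move=> phiE; have [L LE] := freealg_lift phi.
have [s t r [i j ij]|f fE] := @presalg_lift K _ (qsym_rel q) M L.
  rewrite !fgen_fword !fwordM linearB linearZ linearB linearZ /=.
  by rewrite !sandwich_fword !LE phiE // subrr.
by exists f => w; rewrite fE LE.
Qed.

Lemma qext_lift (M : lmodType K) (phi : seq 'I_n -> M) :
    (forall s t (i j : 'I_n),
       phi (s ++ [:: i; j] ++ t) = - q j i *: phi (s ++ [:: j; i] ++ t)) ->
  exists f : {linear qext q -> M}, forall w, f (pword (qext_rel q) w) = phi w.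
Proof.
move=> phiE; have [L LE] := freealg_lift phi.
have [s t r [i j]|f fE] := @presalg_lift K _ (qext_rel q) M L.
  rewrite !fgen_fword !fwordM linearD linearZ linearD linearZ /=.
  by rewrite !sandwich_fword !LE phiE scaleNr addNr.
by exists f => w; rewrite fE LE.
Qed.

Definition quadratic (M : zmodType) (F : 'I_n -> 'I_n -> M) (w : seq 'I_n) : M :=
  if w is [:: a; b] then F a b else 0.

Lemma quadratic_sandwich (M : zmodType) (F : 'I_n -> 'I_n -> M) s t i j :
  quadratic F (s ++ [:: i; j] ++ t) = if nilp s && nilp t then F i j else 0.
Proof. by case: s => [|x [|y [|z s]]]; case: t. Qed.

(** A quadratic relator between words that are not both empty has degree at least three, where
    [quadratic F] vanishes; only the relators themselves constrain F. *)
Lemma qsym_quadratic (M : lmodType K) (F : 'I_n -> 'I_n -> M) :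
    (forall i j : 'I_n, (i < j)%N -> F j i = q i j *: F i j) ->
  exists f : {linear qsym q -> M},
    forall a b, f (pgen (qsym_rel q) a * pgen (qsym_rel q) b) = F a b.
Proof.
move=> FE; have [s t i j ij|f fE] := @qsym_lift M (quadratic F).
  by rewrite !quadratic_sandwich; case: andb; rewrite ?scaler0 // FE.
by exists f => a b; rewrite !pgen_pword -pword_cat fE.
Qed.

Lemma qext_quadratic (M : lmodType K) (F : 'I_n -> 'I_n -> M) :
    (forall i j, F i j = - q j i *: F j i) ->
  exists f : {linear qext q -> M},
    forall a b, f (pgen (qext_rel q) a * pgen (qext_rel q) b) = F a b.
Proof.
move=> FE; have [s t i j|f fE] := @qext_lift M (quadratic F).
  by rewrite !quadratic_sandwich; case: andb; rewrite ?scaler0.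
by exists f => a b; rewrite !pgen_pword -pword_cat fE.
Qed.

(** The relators have degree two, so taking the coefficient of the word v_i passes to the
    quotient. *)
Lemma qsym_free1 (c : 'I_n -> K) :
  \sum_i c i *: pgen (qsym_rel q) i = 0 -> forall i, c i = 0.
Proof.
move=> c0 i; pose phi (w : seq 'I_n) : K^o := (w == [:: i])%:R.
have [s t k l kl|f fE] := @qsym_lift _ phi.
  by rewrite /phi; case: s => [|x [|y s]]; rewrite /= !eqseq_cons /= ?andbF scaler0.
have fX j : f (pgen (qsym_rel q) j) = (j == i)%:R.
  by rewrite pgen_pword fE /phi eqseq_cons andbT.
have E0 := etrans (esym (linear_comb f _ c _)) (etrans (congr1 f c0) (linear0 f)).
have {E0} : \sum_j c j *: ((j == i)%:R : K^o) = 0.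
  by rewrite -[RHS]E0; apply: eq_bigr => j _; congr (_ *: _); exact: esym (fX j).
rewrite (bigD1 i) //= eqxx big1 ?addr0 => [|j /negPf ->].
  by move=> E0; rewrite -[c i]mulr1.
by rewrite scaler0.
Qed.

Lemma qsym_scale1_inj (a b : K) : a *: (1 : qsym q) = b *: (1 : qsym q) -> a = b.
Proof.
pose phi (w : seq 'I_n) : K^o := (w == [::])%:R.
have [s t k l kl|f fE] := @qsym_lift _ phi.
  by rewrite /phi; case: s => [|x s]; rewrite /= ?scaler0.
have fZ c : f (c *: (1 : qsym q)) = c.
  rewrite -(pword_nil (qsym_rel q)) linearZ [f _]fE /phi eqxx; exact: mulr1.
by move=> E; rewrite -[a]fZ E fZ.
Qed.

End QuadraticFunctionals.

Section Actions.
Variables (K : fieldType) (n : nat) (gT : finGroupType).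
Variable rho : mx_representation K [set: gT]%G n.
Variable rel : freealg K 'I_n -> Prop.
Hypothesis acts : acts_as_automorphisms rho rel.
Local Notation X i := (pgen rel i).

Lemma ext_aut_pgen g i : ext_aut acts g (X i) = \sum_a rho g a i *: X a.
Proof.
rewrite -pvec_delta ext_aut_pvec; by apply: eq_bigr => a _; rewrite -colE mxE.
Qed.

Lemma ext_aut_pgen2 g j i : ext_aut acts g (X j * X i) =
  \sum_a \sum_b (rho g a j * rho g b i) *: (X a * X b).
Proof.
rewrite rmorphM !ext_aut_pgen mulr_suml; apply: eq_bigr => a _.
rewrite mulr_sumr; apply: eq_bigr => b _.
by rewrite -quotalg_scalerAl -quotalg_scalerAr scalerA.
Qed.

Lemma ext_autK g x : ext_aut acts g^-1%g (ext_aut acts g x) = x.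
Proof. by rewrite -ext_autM mulVg ext_aut1. Qed.

Lemma linear_ext_aut_pgen2 (M : lmodType K) (f : {linear presalg K 'I_n rel -> M})
    (D : 'I_n -> 'I_n -> M) g i j : (forall a b, f (X a * X b) = D a b) ->
  f (ext_aut acts g (X j * X i)) =
  \sum_a \sum_b (rho g a j * rho g b i) *: D a b.
Proof.
move=> fD; rewrite ext_aut_pgen2 linear_sum; apply: eq_bigr => a _.
by rewrite linear_comb; apply: eq_bigr => b _; rewrite fD.
Qed.

End Actions.

Lemma sum2_delta (K : fieldType) (n : nat) (c : 'I_n -> 'I_n -> K) k l :
  \sum_a \sum_b c a b * ((a == k) && (b == l))%:R = c k l.
Proof.
rewrite (bigD1 k) //= [X in _ + X]big1 ?addr0 => [|a /negPf ak]; last first.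
  by rewrite big1 // => b _; rewrite ak mulr0.
rewrite (bigD1 l) //= !eqxx mulr1 big1 ?addr0 // => b /negPf bl.
by rewrite bl andbF mulr0.
Qed.

(** * Compatibility of the parameters with the group action *)

Section StableParams.
Variables (K : fieldType) (n : nat) (gT : finGroupType).
Variable rho : mx_representation K [set: gT]%G n.
Variable q : 'M[K]_n.
Hypotheses (two : (2%:R : K) != 0) (hq : quantum_system q).
Hypothesis actS : acts_as_automorphisms rho (qsym_rel q).
Hypothesis actE : acts_as_automorphisms rho (qext_rel q).

Lemma qsymC i j : pgen (qsym_rel q) j * pgen (qsym_rel q) i =
  q i j *: (pgen (qsym_rel q) i * pgen (qsym_rel q) j).
Proof.
have [qn0 qii qinv] := hq.
have lt (a b : 'I_n) : (a < b)%N -> pgen (qsym_rel q) b * pgen (qsym_rel q) a =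
    q a b *: (pgen (qsym_rel q) a * pgen (qsym_rel q) b).
  by move=> ab; rewrite /pgen -!qprojM -qprojZ; apply: qproj_rel; exact: QSymRel.
case: (ltngtP i j) => [/lt //|/lt->|/val_inj->]; last by rewrite qii scale1r.
by rewrite scalerA qinv mulVf // scale1r.
Qed.

Lemma qextC i j : pgen (qext_rel q) i * pgen (qext_rel q) j =
  - q j i *: (pgen (qext_rel q) j * pgen (qext_rel q) i).
Proof.
rewrite /pgen -!qprojM -qprojZ; apply: qproj_rel.
by rewrite scaleNr opprK; exact: QExtRel.
Qed.

(* Let A = rho_lj rho_ki and B = rho_kj rho_li.  The coefficients of v_k v_l in
   the images of the two quadratic relations give
   B + q_kl A = q_ij A + q_ij q_kl B and B - q_kl A = - q_ij A + q_ij q_kl B. *)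
Lemma acts_stable_params : stable_params rho q.
Proof.
have [qn0 qii qinv] := hq; move=> g l k i j.
have qq : q l k * q k l = 1 by rewrite qinv mulVf.
(* For k different from l, s = 1 and s = -1 give the coefficient of v_k v_l in degree two of the
   symmetric and of the exterior algebra, where v_l v_k = s q_kl v_k v_l. The formula respects the
   relations for k = l too. *)
pose D (s : K) a b : K^o :=
  ((a == k) && (b == l))%:R + s * q k l * ((a == l) && (b == k))%:R.
have DC s a b : s * s = 1 -> D s b a = (s * q a b) *: D s a b.
  move=> ss; rewrite /D /GRing.scale /= mulrDr.
  have -> : s * q a b * ((a == k) && (b == l))%:R =
      s * q k l * ((a == k) && (b == l))%:R.
    by case: andP => [[/eqP-> /eqP->]|]; rewrite ?mulr0.
  have -> : s * q a b * (s * q k l * ((a == l) && (b == k))%:R) =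
      ((a == l) && (b == k))%:R.
    case: andP => [[/eqP-> /eqP->]|]; rewrite ?mulr0 // mulr1.
    by rewrite mulrACA ss qq mulr1.
  by rewrite addrC ![(b == _) && _]andbC.
have sumD s (c : 'I_n -> 'I_n -> K) :
    \sum_a \sum_b c a b * D s a b = c k l + s * q k l * c l k.
  under eq_bigr => a _.
    under eq_bigr => b _ do rewrite mulrDr mulrCA.
    rewrite big_split -mulr_sumr; over.
  by rewrite big_split -mulr_sumr /= !sum2_delta.
have [fS fSE] : exists f : {linear qsym q -> K^o},
    forall a b, f (pgen (qsym_rel q) a * pgen (qsym_rel q) b) = D 1 a b.
  by apply: qsym_quadratic => a b _; rewrite [LHS]DC ?mul1r.
have [fE fEE] : exists f : {linear qext q -> K^o},
    forall a b, f (pgen (qext_rel q) a * pgen (qext_rel q) b) = D (-1) a b.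
  by apply: qext_quadratic => a b; rewrite [LHS]DC ?mulN1r ?opprK.
have ES : fS (ext_aut actS g (pgen (qsym_rel q) j * pgen (qsym_rel q) i)) =
    q i j *: fS (ext_aut actS g (pgen (qsym_rel q) i * pgen (qsym_rel q) j)).
  by rewrite qsymC ext_autZ; exact: linearZ.
have EE : fE (ext_aut actE g (pgen (qext_rel q) j * pgen (qext_rel q) i)) =
    - q i j *: fE (ext_aut actE g (pgen (qext_rel q) i * pgen (qext_rel q) j)).
  by rewrite qextC ext_autZ; exact: linearZ.
have {}ES := etrans (esym (linear_ext_aut_pgen2 actS g i j fSE)) (etrans ES
  (congr1 _ (linear_ext_aut_pgen2 actS g j i fSE))).
have {}EE := etrans (esym (linear_ext_aut_pgen2 actE g i j fEE)) (etrans EE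
  (congr1 _ (linear_ext_aut_pgen2 actE g j i fEE))).
move: ES EE; rewrite /GRing.scale /= !sumD => ES EE.
(* Subtracting the two identities gives 2 q_kl A = 2 q_ij A. *)
apply: (mulfI two); apply/eqP; rewrite -subr_eq0; apply/eqP.
have /= E0 := congr2 (fun x y => x - y) ES EE.
by rewrite -[RHS](subrr (rho g k j * rho g l i + 1 * q k l * (rho g l j * rho g k i)
  - (rho g k j * rho g l i + -1 * q k l * (rho g l j * rho g k i)))) [X in _ = X - _]E0; ring.
Qed.

End StableParams.

(** * Cochains with values in the skew group algebra *)

Section Cochains.
Variables (K : fieldType) (n : nat) (gT : finGroupType).
Variable rho : mx_representation K [set: gT]%G n.
Variable q : 'M[K]_n.
Hypothesis actS : acts_as_automorphisms rho (qsym_rel q).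
Hypothesis actE : acts_as_automorphisms rho (qext_rel q).
Local Notation act := (ext_action actS).
Local Notation AG := (Defs.skew act).
Local Notation X i := (pgen (qsym_rel q) i).
Local Notation W i := (pgen (qext_rel q) i).
Local Notation v i := (skew_alg act (X i)).
Local Notation t g := (skew_t act g).
Local Notation gr := (skew_grpalg actS).
Implicit Types (c : grpalg K gT) (g h k : gT).

Lemma skew_sumE (T : Type) (r : seq T) (F : T -> AG) k :
  (\sum_(i <- r) F i : {ffun gT -> qsym q}) k = \sum_(i <- r) (F i : {ffun gT -> qsym q}) k.
Proof. exact: sum_ffunE. Qed.

Lemma skewD (x y : AG) k : (x + y : {ffun gT -> qsym q}) k =
  (x : {ffun gT -> qsym q}) k + (y : {ffun gT -> qsym q}) k.
Proof. exact: ffunE. Qed.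

Lemma skewZ a (x : AG) k :
  (a *: x : {ffun gT -> qsym q}) k = a *: (x : {ffun gT -> qsym q}) k.
Proof. exact: ffunE. Qed.

Lemma skew_grpalgE c g : (gr c : {ffun gT -> qsym q}) g = c g *: (1 : qsym q).
Proof.
rewrite /skew_grpalg skew_sumE (bigD1 g) //= big1 => [|h /negPf hg].
  by rewrite !ffunE eqxx addr0.
by rewrite !ffunE eq_sym hg scaler0.
Qed.

Lemma skew_grpalg_inj : injective gr.
Proof.
move=> c d E; apply/ffunP => g.
by apply: (@qsym_scale1_inj _ _ q); rewrite -!skew_grpalgE E.
Qed.

Lemma skew_tM g h : t g * t h = t (g * h)%g.
Proof. by rewrite /skew_t skew_eltM rmorph1 mulr1. Qed.

Lemma skew_conj c h : t h * gr c * t h^-1%g = gr [ffun k => c (h^-1 * k * h)%g].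
Proof.
rewrite /skew_grpalg mulr_sumr mulr_suml [RHS](reindex_inj (conjg_inj h^-1%g)).
apply: eq_bigr => g _; rewrite -skew_scalerAr -skew_scalerAl !skew_tM ffunE.
by rewrite conjgE invgK !mulgA mulVg mul1g mulgKV.
Qed.

Lemma skew_valg c i k : (v i * gr c : {ffun gT -> qsym q}) k = c k *: X i.
Proof.
rewrite ffunE (bigD1 1%g) //= big1 => [|g /negPf g1]; last by rewrite ffunE g1 mul0r.
rewrite ffunE eqxx invg1 mul1g skew_grpalgE addr0.
by rewrite (act_one act) -quotalg_scalerAr mulr1.
Qed.

Lemma skew_algv c i k : (gr c * v i : {ffun gT -> qsym q}) k =
  c k *: \sum_l rho k l i *: X l.
Proof.
rewrite ffunE (bigD1 k) //= big1 => [|g gk]; last first.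
  by rewrite ffunE -eq_mulVg1 (negPf gk) rmorph0 mulr0.
rewrite skew_grpalgE ffunE mulVg eqxx addr0 -quotalg_scalerAl mul1r.
by rewrite -(ext_aut_pgen actS).
Qed.

End Cochains.

Lemma linear_for_comb (K : fieldType) (U V : lmodType K) (f : U -> V)
    (T : Type) (r : seq T) (c : T -> K) (F : T -> U) : linear f ->
  f (\sum_(x <- r) c x *: F x) = \sum_(x <- r) c x *: f (F x).
Proof.
move=> f_lin.
by have := linear_comb (HB.pack f (GRing.isLinear.Build K U V *:%R f f_lin)) r c F.
Qed.

(* Stated for abstract modules, where rewriting with linearity is cheap. *)
Lemma linear_pairs3 (K : fieldType) (U V : lmodType K) (e : U -> V)
    (J : finType) (X : J -> V) s1 s2 s3 p1 p2 p3 r1 r2 r3 x1 x2 x3 y1 y2 y3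
    (F1 F2 F3 G1 G2 G3 : J -> K) : linear e ->
    e x1 = \sum_l F1 l *: X l -> e y1 = \sum_l G1 l *: X l ->
    e x2 = \sum_l F2 l *: X l -> e y2 = \sum_l G2 l *: X l ->
    e x3 = \sum_l F3 l *: X l -> e y3 = \sum_l G3 l *: X l ->
  e (s1 *: (p1 *: x1 - r1 *: y1) + (s2 *: (p2 *: x2 - r2 *: y2)
     + s3 *: (p3 *: x3 - r3 *: y3))) =
  \sum_l (s1 * (p1 * F1 l - r1 * G1 l) + (s2 * (p2 * F2 l - r2 * G2 l)
     + s3 * (p3 * F3 l - r3 * G3 l))) *: X l.
Proof.
move=> e_lin E1 D1 E2 D2 E3 D3.
have eB := zmod_morphism_linear e_lin.
have eZ a x : e (a *: x) = a *: e x by exact: (scalable_linear e_lin).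
have eD x y : e (x + y) = e x + e y by have := e_lin 1 x y; rewrite !scale1r.
have step s p r x y (F G : J -> K) : e x = \sum_l F l *: X l ->
    e y = \sum_l G l *: X l ->
    e (s *: (p *: x - r *: y)) = \sum_l (s * (p * F l - r * G l)) *: X l.
  move=> xE yE; rewrite eZ eB !eZ xE yE !scaler_sumr -sumrB scaler_sumr.
  by apply: eq_bigr => l _; rewrite !scalerA -scalerBl scalerA.
rewrite !eD (step _ _ _ _ _ _ _ E1 D1) (step _ _ _ _ _ _ _ E2 D2).
rewrite (step _ _ _ _ _ _ _ E3 D3) -!big_split; apply: eq_bigr => l _ /=.
by rewrite -!scalerDl.
Qed.

Lemma sum_ord3 (V : nmodType) (F : 'I_3 -> V) :
  \sum_(i < 3) F i = F ord0 + (F (lift ord0 ord0) + F (lift ord0 (lift ord0 ord0))).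
Proof. by rewrite !big_ord_recl big_ord0 addr0. Qed.

Lemma prod_ord3 (R : pzRingType) (P : pred 'I_3) (F : 'I_3 -> R) :
  \prod_(i < 3 | P i) F i = (if P ord0 then F ord0 else 1)
    * ((if P (lift ord0 ord0) then F (lift ord0 ord0) else 1)
    * (if P (lift ord0 (lift ord0 ord0)) then F (lift ord0 (lift ord0 ord0)) else 1)).
Proof. by rewrite big_mkcond !big_ord_recl big_ord0 /= mulr1. Qed.

(** * Invariance and the cocycle condition in coordinates *)

Section Main.
Variables (K : fieldType) (n : nat) (gT : finGroupType).
Variable rho : mx_representation K [set: gT]%G n.
Variable q : 'M[K]_n.
Hypothesis actS : acts_as_automorphisms rho (qsym_rel q).
Hypothesis actE : acts_as_automorphisms rho (qext_rel q).
Variable kap : 'I_n -> 'I_n -> grpalg K gT.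
Local Notation act := (ext_action actS).
Local Notation AG := (Defs.skew act).
Local Notation X i := (pgen (qsym_rel q) i).
Local Notation W i := (pgen (qext_rel q) i).
Local Notation v i := (skew_alg act (X i)).
Local Notation t g := (skew_t act g).
Local Notation gr := (skew_grpalg actS).
Implicit Types (g h k : gT).

Lemma qext_degree_sum m (T : Type) (r : seq T) (F : T -> qext q) :
  (forall x, qext_degree m (F x)) -> qext_degree m (\sum_(x <- r) F x).
Proof.
move=> degF; elim/big_rec: _ => [|x y _ [c ->]].
  by exists (fun=> 0); rewrite big1 // => d _; rewrite scale0r.
have [c' ->] := degF x; exists (fun d => c' d + c d).
by rewrite -big_split; apply: eq_bigr => d _; rewrite scalerDl.
Qed.

Lemma qext_degreeZ m a (x : qext q) : qext_degree m x -> qext_degree m (a *: x).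
Proof.
move=> [c ->]; exists (fun d => a * c d).
by rewrite scaler_sumr; apply: eq_bigr => d _; rewrite scalerA.
Qed.

Lemma qext_degree2 a b : qext_degree 2 (W a * W b).
Proof.
pose d0 : {ffun 'I_2 -> 'I_n} := [ffun s => if s == ord0 then a else b].
exists (fun d => (d == d0)%:R); rewrite (bigD1 d0) //= eqxx scale1r.
rewrite [Y in _ + Y]big1 => [|d /negPf ->]; last by rewrite scale0r.
by rewrite !big_ord_recl big_ord0 mulr1 addr0 !ffunE.
Qed.

Section Cochain.
Variable f : {linear qext q -> AG}.
Hypothesis fE : forall i j, f (W j * W i) = gr (kap i j).

Lemma cochain_ext_aut h i j : f (ext_aut actE h (W j * W i)) =
  gr [ffun g => \sum_a \sum_b rho h a j * rho h b i * kap b a g].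
Proof.
rewrite (linear_ext_aut_pgen2 _ _ _ _ (fun a b => fE b a)).
apply/ffunP => g; rewrite skew_sumE skew_grpalgE ffunE scaler_suml.
apply: eq_bigr => a _; rewrite skew_sumE scaler_suml.
by apply: eq_bigr => b _; rewrite ffunE skew_grpalgE scalerA.
Qed.

(** The products w_j w_i span degree two, and on them both sides lie in the group algebra, which
    embeds in A # G; so coefficients of t_k can be compared. *)
Lemma invariant_stable : is_invariant actE 2 f <-> stable_form rho kap.
Proof.
split=> [inv h k i j | Hk h x [c ->]].
  (* Invariance is applied to h(w_j w_i), so that h^-1 cancels. *)
  have deg2 : qext_degree 2 (ext_aut actE h (W j * W i)).
    rewrite ext_aut_pgen2; apply: qext_degree_sum => a.
    apply: qext_degree_sum => b; apply: qext_degreeZ; exact: qext_degree2.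
  have := inv h _ deg2; rewrite ext_autK fE skew_conj cochain_ext_aut.
  by move/skew_grpalg_inj/ffunP/(_ k); rewrite !ffunE => <-.
have E (d : {ffun 'I_2 -> 'I_n}) :
    \prod_(s < 2) W (d s) = W (d ord0) * W (d (lift ord0 ord0)).
  by rewrite !big_ord_recl big_ord0 mulr1.
have conj_lin : linear (fun y => t h * f (ext_aut actE h^-1%g y) * t h^-1%g).
  move=> a y z; rewrite rmorphD ext_autZ (linearP f) mulrDr mulrDl.
  by rewrite -skew_scalerAr -skew_scalerAl.
apply: etrans (linear_for_comb _ _ _ conj_lin) _.
apply: etrans _ (esym (linear_comb f _ _ _)).
apply: eq_bigr => d _; rewrite E; congr (_ *: _).
rewrite cochain_ext_aut skew_conj fE; congr (gr _).
apply/ffunP => k; rewrite !ffunE Hk invgK.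
by congr (kap _ _ _); rewrite !mulgA mulgV mul1g mulgK.
Qed.

(** At t_g the coboundary has degree one in A: v_i t_g yields a Kronecker delta and t_g v_i = g(v_i)
    t_g a column of rho. The indices appear reversed because f sends w_j w_i to kappa(v_i, v_j). *)
Lemma koszul_jac (j : 'I_3 -> 'I_n) g :
  (koszul_coboundary f j : {ffun gT -> qsym q}) g =
  - \sum_l jac rho q kap (j (lift ord0 (lift ord0 ord0))) (j (lift ord0 ord0))
      (j ord0) g l *: X l.
Proof.
rewrite /koszul_coboundary sum_ord3.
set c := j ord0; set b := j (lift ord0 ord0); set a := j (lift ord0 (lift ord0 ord0)).
have -> : f (\prod_(s < 3 | s != ord0) W (j s)) = gr (kap a b).
  by rewrite prod_ord3 /= mul1r; exact: fE.
have -> : f (\prod_(s < 3 | s != lift ord0 ord0) W (j s)) = gr (kap a c).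
  by rewrite prod_ord3 /= mul1r; exact: fE.
have -> : f (\prod_(s < 3 | s != lift ord0 (lift ord0 ord0)) W (j s)) = gr (kap b c).
  by rewrite prod_ord3 /= mulr1; exact: fE.
have -> : \prod_(s < 3 | (s < (ord0 : 'I_3))%N) q c (j s) = 1.
  by rewrite prod_ord3 /= !mulr1.
have -> : \prod_(s < 3 | ((ord0 : 'I_3) < s)%N) q (j s) c = q b c * q a c.
  by rewrite prod_ord3 /= !mul1r.
have -> : \prod_(s < 3 | (s < (lift ord0 ord0 : 'I_3))%N) q b (j s) = q b c.
  by rewrite prod_ord3 /= !mulr1.
have -> : \prod_(s < 3 | ((lift ord0 ord0 : 'I_3) < s)%N) q (j s) b = q a b.
  by rewrite prod_ord3 /= !mul1r.
have -> : \prod_(s < 3 | (s < (lift ord0 (lift ord0 ord0) : 'I_3))%N) q a (j s) =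
    q a c * q a b.
  by rewrite prod_ord3 /= !mulr1.
have -> : \prod_(s < 3 | ((lift ord0 (lift ord0 ord0) : 'I_3) < s)%N) q (j s) a = 1.
  by rewrite prod_ord3 /= !mul1r.
have XE i : X i = \sum_l (l == i)%:R *: X l.
  rewrite (bigD1 i) //= eqxx scale1r big1 ?addr0 // => l /negPf ->.
  by rewrite scale0r.
have valg i d : (v i * gr d : {ffun gT -> qsym q}) g = \sum_l (d g * (l == i)%:R) *: X l.
  rewrite skew_valg {1}XE scaler_sumr; apply: eq_bigr => l _.
  by rewrite scalerA.
have algv i d : (gr d * v i : {ffun gT -> qsym q}) g = \sum_l (d g * rho g l i) *: X l.
  by rewrite skew_algv scaler_sumr; apply: eq_bigr => l _; rewrite scalerA.
have eval_lin : linear (fun x : AG => (x : {ffun gT -> qsym q}) g).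
  by move=> s x y; rewrite skewD skewZ.
apply: etrans (linear_pairs3 _ _ _ _ _ _ _ _ _ eval_lin (valg c (kap a b))
  (algv c (kap a b)) (valg b (kap a c)) (algv b (kap a c)) (valg a (kap b c))
  (algv a (kap b c))) _.
rewrite -sumrN; apply: eq_bigr => l _; rewrite -scaleNr; congr (_ *: _).
by rewrite /jac /=; ring.
Qed.

(** By [koszul_jac] and the independence of the v_l in S_Q(V). *)
Lemma cocycle_jacobi : is_cocycle 2 f <-> jacobi rho q kap.
Proof.
split=> [coc a b c g l ab bc ac | HJ j j_inj].
  pose j (s : 'I_3) := nth c [:: c; b; a] s.
  have j_inj : injective j.
    have : uniq [:: c; b; a] by rewrite /= !inE !negb_or !andbT eq_sym bc eq_sym ac eq_sym ab.
    move=> u s1 s2 E; apply/val_inj/eqP.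
    by rewrite -(@nth_uniq _ c [:: c; b; a] s1 s2 (ltn_ord s1) (ltn_ord s2) u); apply/eqP.
  have := congr1 (fun x : AG => (x : {ffun gT -> qsym q}) g) (coc j j_inj).
  rewrite koszul_jac [RHS]ffunE /j /= => /eqP; rewrite oppr_eq0 => /eqP E0.
  exact: qsym_free1 E0 l.
apply/ffunP => g; rewrite koszul_jac [RHS]ffunE big1 ?oppr0 // => l _.
by rewrite HJ ?scale0r // (inj_eq j_inj).
Qed.

End Cochain.
End Main.

(** Used for left multiplication by t_g in H, which on [hword] is [tact g]. *)
Lemma good_linear (K : fieldType) (n : nat) (gT : finGroupType)
    (rho : mx_representation K [set: gT]%G n) (q : 'M[K]_n)
    (kap : 'I_n -> 'I_n -> grpalg K gT) (M M' : lmodType K) (f : M -> M')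
    (Th : seq 'I_n -> gT -> M) : linear f ->
  good rho q kap Th -> good rho q kap (fun w h => f (Th w h)).
Proof.
move=> f_lin goodTh u j i v h; rewrite /defect /corr (defectE (goodTh u j i v h)).
have fD x y : f (x + y) = f x + f y by have := f_lin 1 x y; rewrite !scale1r.
have f0 : f 0 = 0 by rewrite -[0](subrr 0) (zmod_morphism_linear f_lin) subrr.
rewrite f_lin [f (corr _ _ _ _ _ _ _)](big_morph f fD f0).
apply/eqP; rewrite subr_eq0; apply/eqP; congr (_ + _); apply: eq_bigr => g _.
by rewrite (scalable_linear f_lin) /tact -twist_linear.
Qed.

(** * Necessity of the Jacobi identity and of invariance *)

Section PBWConsequences.
Variables (K : fieldType) (n : nat) (gT : finGroupType).
Variable rho : mx_representation K [set: gT]%G n.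
Variables (q : 'M[K]_n) (kap : 'I_n -> 'I_n -> grpalg K gT).
Local Notation hword := (hword rho q kap).
Hypothesis pbw : quantum_Drinfeld_Hecke rho q kap.

Definition exponents (w : seq 'I_n) : {ffun 'I_n -> nat} :=
  [ffun i => count_mem i w].

Lemma hword_monomial w g : sorted (@ord_leq n) w ->
  hword w g = hecke_monomial rho q kap (exponents w, g).
Proof. by move=> sw; rewrite hecke_monomialE /= -sorted_wordK. Qed.

Lemma exponents_inj w w' : sorted (@ord_leq n) w -> sorted (@ord_leq n) w' ->
  exponents w = exponents w' -> w = w'.
Proof.
move=> /sorted_wordK Dw /sorted_wordK Dw' E.
exact: etrans Dw (etrans (congr1 (@sorted_word n) E) (esym Dw')).
Qed.

Lemma hword_free (T : finType) (w : T -> seq 'I_n) (g : T -> gT) (c : T -> K) :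
    (forall t, sorted (@ord_leq n) (w t)) -> injective (fun t => (w t, g t)) ->
    \sum_t c t *: hword (w t) (g t) = 0 ->
  forall t, c t = 0.
Proof.
move=> sw inj_wg c0; apply: (is_basis_free (iota := fun t => (exponents (w t), g t)) pbw).
  move=> t t' [Ew Eg]; apply: inj_wg; congr (_, _) => //.
  by apply: exponents_inj => //; apply/ffunP => i; rewrite Ew.
by rewrite -[RHS]c0; apply: eq_bigr => t _; rewrite hword_monomial.
Qed.

(** For [hword], [good_jac] is a linear relation among the basis monomials v_l t_g. *)
Lemma pbw_jacobi : jacobi rho q kap.
Proof.
move=> a b c g l _ _ _; have E0 := good_jac a b c (hword_good rho q kap).
rewrite pair_bigA in E0.
by apply: (hword_free _ _ E0 (g, l)) => // [[g1 l1] [g2 l2] [-> ->]].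
Qed.

(** Both [hword] and its product with t_g on the left are good, so at empty words [defect_tact_form]
    reduces to a relation among the basis elements t_kg with coefficients [form_defect]. *)
Lemma pbw_stable_form : stable_params rho q -> stable_form rho kap.
Proof.
move=> Hq g k i j; apply/eqP; rewrite -subr_eq0; apply/eqP.
have gooT : good rho q kap (tact rho g hword).
  have -> : tact rho g hword =
      (fun w h => pgen (hecke_rel rho q kap) (inr g) * hword w h).
    by apply/funext => w; apply/funext => h; rewrite heckeT_hword.
  by apply: good_linear (hword_good rho q kap); exact: quotalg_mulr_linear.
have := defect_tact_form kap hword g [::] j i [::] 1%g Hq.
rewrite gooT /= big1 => [|a _]; last first.
  by rewrite big1 // => b _; rewrite hword_good scaler0.
rewrite add0r => /esym E0.
by apply: (hword_free _ _ E0 k) => // k1 k2 [/mulIg/mulIg].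
Qed.

End PBWConsequences.

(** The cochain is extended by zero outside degree two; the exterior relations are respected because
    kappa is a quantum 2-form. *)
Lemma induced_cochain (K : fieldType) (n : nat) (gT : finGroupType)
    (rho : mx_representation K [set: gT]%G n) (q : 'M[K]_n)
    (actS : acts_as_automorphisms rho (qsym_rel q))
    (kap : 'I_n -> 'I_n -> grpalg K gT) :
    quantum_system q -> quantum_2form q kap ->
  exists f : {linear qext q -> Defs.skew (ext_action actS)},
    forall i j, f (pgen (qext_rel q) j * pgen (qext_rel q) i) =
      skew_grpalg actS (kap i j).
Proof.
move=> [qn0 qii qinv] [kii kapC].
have [i j|f fE] := @qext_quadratic K n q (Defs.skew (ext_action actS))
  (fun a b => skew_grpalg actS (kap b a)); last by exists f => i j; exact: fE.
apply/ffunP => g; apply: etrans (skew_grpalgE _ _ _) (esym _).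
apply: etrans (skewZ _ _ _) (etrans (congr1 _ (skew_grpalgE _ _ _)) _).
rewrite scalerA; apply: (congr1 (fun s : K => s *: (1 : qsym q))).
case: (eqVneq i j) => [->|ij]; first by rewrite kii ffunE mulr0.
by rewrite (kapC i j) // (qinv j i).
Qed.

Lemma PBW_iff_cocycle (K : fieldType) (two : (2%:R : K) != 0) (n : nat)
    (gT : finGroupType) (rho : mx_representation K [set: gT]%G n) (q : 'M[K]_n)
    (hq : quantum_system q) (actS : acts_as_automorphisms rho (qsym_rel q))
    (actE : acts_as_automorphisms rho (qext_rel q))
    (kap : 'I_n -> 'I_n -> grpalg K gT) (hkap : quantum_2form q kap) :
  quantum_Drinfeld_Hecke rho q kap <-> induces_cocycle actS actE kap.
Proof.
have Hq := acts_stable_params two hq actS actE.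
split=> [pbw | [f [fE coc inv]]].
  have [f fE] := induced_cochain actS hq hkap.
  exists f; split=> //; first exact/(cocycle_jacobi fE)/pbw_jacobi.
  exact/(invariant_stable actE fE)/(pbw_stable_form pbw Hq).
apply: hecke_PBW => //; first exact/(invariant_stable actE fE).
exact/(cocycle_jacobi fE).
Qed.

Theorem theorem9p4 (R : realType) (n : nat) (gT : finGroupType)
    (rho : mx_representation R[i] [set: gT]%G n) (rho_inj : mx_faithful rho)
    (q : 'M[R[i]]_n) (hq : quantum_system q)
    (actS : acts_as_automorphisms rho (qsym_rel q))
    (actE : acts_as_automorphisms rho (qext_rel q))
    (kap : 'I_n -> 'I_n -> grpalg R[i] gT) (hkap : quantum_2form q kap) :
  quantum_Drinfeld_Hecke rho q kap <-> induces_cocycle actS actE kap.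
Proof. by apply: PBW_iff_cocycle => //; rewrite Num.Theory.pnatr_eq0. Qed.
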